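(* Let $d\ge1$ and $A\in\mathrm{GL}_d(\mathcal{P})$. There exist - an integer $\sigma\ge1$ and $\mathbf r=(r_1,\ldots,r_\sigma)\in\mathbb{Z}_{\ge1}^\sigma$ with $r_1+\cdots+r_\sigma=d$; - an invertible block upper triangular matrix $\Theta\in\mathrm{GL}_d(\overline{\mathbb{Q}}[z^{-1/\infty}])$ (blocks of sizes $r_1,\ldots,r_\sigma$) whose diagonal blocks are $A_1\in\mathrm{GL}_{r_1}(\overline{\mathbb{Q}}),\ldots,A_\sigma\in\mathrm{GL}_{r_\sigma}(\overline{\mathbb{Q}})$, and whose constant term (coefficient of $z^0$) is denoted $C\in\mathrm{GL}_d(\overline{\mathbb{Q}})$; - $F_1\in\mathrm{GL}_d(\mathcal{P})$; - $F_2\in\mathfrak{V}_{\mathbf r}$; such that $A=\phi_p(F_1)\Theta F_1^{-1}$ and $\Theta=\phi_p(F_2)CF_2^{-1}$. In particular $F=F_1F_2\in\mathrm{GL}_d(\mathscr{H})$ satisfies $A=\phi_p(F)CF^{-1}$.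
   Context: Fix an integer $p\ge2$. $\overline{\mathbb{Q}}$ is the field of algebraic numbers; $\mathcal{P}=\bigcup_{k\ge1}\overline{\mathbb{Q}}((z^{1/k}))$ (Puiseux series); $\overline{\mathbb{Q}}[z^{-1/\infty}]=\bigcup_{k\ge1}\overline{\mathbb{Q}}[z^{-1/k}]$; $\mathscr{H}=\overline{\mathbb{Q}}((z^{\mathbb{Q}}))$ is the field of Hahn series (formal sums $\sum_{\gamma\in\mathbb{Q}}f_\gamma z^\gamma$ with well-ordered support). $\phi_p$ is the automorphism of $\mathscr{H}$ with $\phi_p(\sum f_\gamma z^\gamma)=\sum f_\gamma z^{p\gamma}$, applied entrywise to matrices. Let $\boldsymbol\Lambda_t=\mathbb{Z}_{\ge0}^t\times(\overline{\mathbb{Q}}^\times)^t\times\mathbb{Q}_{>0}^t$. For $\boldsymbol\omega=((\alpha_i),(\lambda_i),(a_i))\in\boldsymbol\Lambda_t$, $t\ge1$, $\xi_{\boldsymbol\omega}=\sum_{k_1,\ldots,k_t\ge1}k_1^{\alpha_1}\cdots k_t^{\alpha_t}\lambda_1^{k_1}\lambda_2^{k_1+k_2}\cdots\lambda_t^{k_1+\cdots+k_t}z^{-\sum_{i=1}^ta_i/p^{k_1+\cdots+k_i}}\in\mathscr{H}$, and $\xi=1$ for the unique element of $\boldsymbol\Lambda_0$. For $s\in\mathbb{Z}_{\ge0}$, $\mathcal{V}_s$ is the $\overline{\mathbb{Q}}$-linear span in $\mathscr{H}$ of $\{z^{-\gamma}\xi_{\boldsymbol\omega}:\gamma\in\mathbb{Q}_{\ge0},\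 \boldsymbol\omega\in\bigcup_{t=0}^s\boldsymbol\Lambda_t\}\setminus\{1\}$. For $\mathbf r=(r_1,\ldots,r_\sigma)\in\mathbb{Z}_{\ge1}^\sigma$ with $\sum r_i=d$, $\mathfrak{V}_{\mathbf r}$ is the set of block upper triangular matrices in $\mathrm{GL}_d(\mathscr{H})$ (blocks of sizes $r_1,\ldots,r_\sigma$) whose diagonal blocks are identity matrices $I_{r_i}$ and whose $(i,j)$-block, for $j>i$, has entries in $\mathcal{V}_{j-i}$. *)

(* Defs.v *)
From HB Require Import structures.
From mathcomp Require Import all_boot all_order all_algebra all_field.
From mathcomp Require Import finmap.
From mathcomp Require Import boolp classical_sets functions cardinality fsbigop.

Set Implicit Arguments.
Unset Strict Implicit.
Unset Printing Implicit Defensive.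

Import Order.TTheory GRing.Theory Num.Theory.

Local Open Scope classical_set_scope.
Local Open Scope ring_scope.

Definition well_ordered (A : set rat) : Prop :=
  forall S : set rat, S `<=` A -> S !=set0 ->
    exists2 m, S m & forall x, S x -> m <= x.

Lemma well_orderedS (A B : set rat) :
  A `<=` B -> well_ordered B -> well_ordered A.
Proof. by move=> AB wB S SA; apply: wB => x /SA /AB. Qed.

Arguments well_orderedS {A B} _ _.

Lemma well_ordered_min (A : set rat) (u : nat -> rat) (N : nat) :
  well_ordered A -> (forall n, A (u n)) ->
  exists n, (N <= n)%N /\ forall k, (N <= k)%N -> u n <= u k.
Proof.
move=> wA uA.
have [||m [n Nn <-] mle] := wA [set x | exists2 n, (N <= n)%N & u n = x].
- by move=> _ [n _ <-].
- by exists (u N), N.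
- by exists n; split=> // k Nk; apply: mle; exists k.
Qed.

Lemma well_ordered_subseq (A : set rat) (u : nat -> rat) :
  well_ordered A -> (forall n, A (u n)) ->
  exists2 h : nat -> nat, {homo h : m n / (m < n)%N} &
    forall m n, (m <= n)%N -> u (h m) <= u (h n).
Proof.
move=> wA uA.
have [g gP] := choice (fun N => well_ordered_min N wA uA).
pose h := fix h n := if n is n'.+1 then g (h n').+1 else g 0%N.
exists h.
- by apply: homo_ltn => [? ? ?|n]; [exact: ltn_trans|case: (gP (h n).+1)].
- apply: (@homo_leq _ (u \o h) (fun x y => x <= y)) => // [x y z|n /=].
    exact: le_trans.
  case: n => [|n].
    by apply: (gP 0%N).2.
  have [gt0 _] := gP (h n).+1; have [gt1 _] := gP (g (h n).+1).+1.
  by apply: (gP (h n).+1).2; exact: ltn_trans gt0 gt1.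
Qed.

Lemma well_ordered_subseqs (T : eqType) (s : seq T) (A : T -> set rat)
    (u : T -> nat -> rat) :
  (forall i, well_ordered (A i)) -> (forall i n, A i (u i n)) ->
  exists2 h : nat -> nat, {homo h : m n / (m < n)%N} &
    forall i m n, i \in s -> (m <= n)%N -> u i (h m) <= u i (h n).
Proof.
move=> wA uA; elim: s => [|j s [h hlt hle]]; first by exists id.
have [g glt gle] := well_ordered_subseq (wA j) (fun n => uA j (h n)).
exists (h \o g) => [m n mn|i m n]; first exact/hlt/glt.
rewrite inE => /orP[/eqP -> mn|si mn]; first exact: gle.
apply: hle => //; move: mn; rewrite leq_eqVlt => /orP[/eqP -> //|/glt].
exact: ltnW.
Qed.

Lemma well_ordered_nodec (A : set rat) :
  (forall u : nat -> rat, (forall n, A (u n)) ->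
     (forall n, u n.+1 < u n) -> False) -> well_ordered A.
Proof.
move=> nodec S SA [s Ss]; apply: contrapT => nomin.
have step x : exists y, S x -> S y /\ y < x.
  have [Sx|nSx] := pselect (S x); last by exists x.
  apply: contrapT => nex; apply: nomin; exists x => // y Sy.
  by rewrite leNgt; apply/negP => yx; apply: nex; exists y.
have [f fP] := choice step.
have Sf n : S (iter n f s) by elim: n => //= n /fP[].
by apply: (nodec (fun n => iter n f s)) => n; [exact/SA/Sf|case: (fP _ (Sf n))].
Qed.

Lemma infinite_inj (T : Type) (A : set T) : infinite_set A ->
  exists2 u : nat -> T, injective u & forall n, A (u n).
Proof.
move=> /infiniteP /card_leP[f].
exists (fun n => val (f (SigSub (mem_set (I : [set: nat] n))))) => [m n|n].
  by move=> /val_inj /(@inj _ _ _ f); rewrite !inE => /(_ I I) [].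
exact: set_valP.
Qed.

Section SummableFamily.

Variables (I : choiceType) (P : set I) (e : I -> rat).
Hypothesis asc : forall u : nat -> I, injective u -> (forall n, P (u n)) ->
  exists m n, (m < n)%N /\ e (u m) < e (u n).

Lemma asc_finite g : finite_set (P `&` e @^-1` [set g]).
Proof.
apply: contrapT => /infinite_inj[u uI uP].
have [n|m [n [_]]] := asc uI; first by case: (uP n).
by rewrite (uP m).2 (uP n).2 ltxx.
Qed.

Lemma asc_well_ordered : well_ordered (e @` P).
Proof.
apply: well_ordered_nodec => u uP udec.
have uP' n : exists i, P i /\ e i = u n by case: (uP n) => i; exists i.
have [v vP] := choice uP'.
have udec' : forall m n, (m < n)%N -> u n < u m.
  apply: (@homo_ltn _ u (fun x y => y < x)) => // x y z xy yz.
  exact: lt_trans yz xy.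
have [||m [n [mn]]] := asc (u := v).
- move=> m n vmn; have : u m = u n by rewrite -(vP m).2 -(vP n).2 vmn.
  by case: (ltngtP m n) => // /udec' ult eu; rewrite eu ltxx in ult.
- by move=> n; case: (vP n).
- by rewrite (vP m).2 (vP n).2 ltNge (ltW (udec' _ _ mn)).
Qed.

End SummableFamily.

Arguments asc_well_ordered {I P e} _.

Lemma well_ordered_add_asc (A B : set rat) (u : nat -> rat * rat) :
  well_ordered A -> well_ordered B -> injective u ->
  (forall n, (A `*` B) (u n)) ->
  exists m n, (m < n)%N /\ (u m).1 + (u m).2 < (u n).1 + (u n).2.
Proof.
move=> wA wB uI uAB.
have [||h hlt hle] := @well_ordered_subseqs bool [:: true; false]
  (fun b => if b then A else B) (fun b n => if b then (u n).1 else (u n).2).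
- by case.
- by case=> n; case: (uAB n).
exists (h 0%N), (h 1%N); split; first exact: hlt.
have le1 := hle true 0%N 1%N isT isT; have le2 := hle false 0%N 1%N isT isT.
rewrite lt_neqAle lerD // andbT; apply/eqP => e.
have : h 0%N = h 1%N.
  apply: uI; rewrite [u (h 0%N)]surjective_pairing [RHS]surjective_pairing.
  have e1 : (u (h 0%N)).1 = (u (h 1%N)).1.
    apply/eqP; rewrite eq_le le1 /= -(lerD2r (u (h 0%N)).2) e lerD2l.
    exact: le2.
  by move: e; rewrite e1 => /addrI ->.
by apply/eqP; rewrite ltn_eqF //; apply: hlt.
Qed.

Lemma well_ordered_add_finite (A B : set rat) (g : rat) :
  well_ordered A -> well_ordered B -> finite_set [set a | A a /\ B (g - a)].
Proof.
move=> wA wB.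
have := asc_finite (P := A `*` B) (e := fun ab => ab.1 + ab.2)
  (fun u => well_ordered_add_asc wA wB) g.
move=> /(finite_image fst); apply: sub_finite_set => a [Aa Bga].
by exists (a, g - a) => //=; split=> //=; rewrite addrC subrK.
Qed.

Lemma well_ordered_add (A B : set rat) :
  well_ordered A -> well_ordered B ->
  well_ordered [set g | exists2 a, A a & B (g - a)].
Proof.
move=> wA wB; apply: (well_orderedS _ (asc_well_ordered (P := A `*` B)
  (e := fun ab => ab.1 + ab.2) (fun u => well_ordered_add_asc wA wB))).
by move=> g [a Aa Bga]; exists (a, g - a) => //=; rewrite addrC subrK.
Qed.
Arguments well_ordered_add {A B} _ _.

Lemma well_ordered_nat (A : set rat) :
  (forall x, A x -> exists n : nat, x = n%:R) -> well_ordered A.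
Proof.
move=> An; apply: well_ordered_nodec => u uA udec.
have [v vP] := choice (fun n => An _ (uA n)).
have vdec n : (v n.+1 < v n)%N by rewrite -(ltr_nat rat) -!vP.
have vle n : (v n + n <= v 0)%N.
  elim: n => [|n IH]; first by rewrite addn0.
  by apply: leq_trans IH; rewrite addnS -addSn leq_add2r.
have := vle (v 0%N).+1; rewrite leqNgt => /negP; apply.
by rewrite addnS ltnS leq_addl.
Qed.

Section Hahn.

Variable K : fieldType.

(* Hahn series K((z^Q)): hcoef f g is the coefficient of z^g in f. *)
Record hahn := Hahn {
  hcoef :> rat -> K;
  hahn_wo : well_ordered [set g | hcoef g != 0] }.

Arguments hahn_wo : clear implicits.

Lemma hahnP (f g : hahn) : f =1 g -> f = g.
Proof.
case: f g => [f wf] [g wg] /= /funext fg.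
by move: wf wg; rewrite fg => wf wg; rewrite (Prop_irrelevance wf wg).
Qed.

HB.instance Definition _ := gen_eqMixin hahn.
HB.instance Definition _ := gen_choiceMixin hahn.

Lemma well_orderedU (A B : set rat) :
  well_ordered A -> well_ordered B -> well_ordered (A `|` B).
Proof.
move=> wA wB S SAB [s Ss].
have [SA0|/set0P SA0] := eqVneq (S `&` A) set0.
  apply: wB; last by exists s.
  by move=> x Sx; case: (SAB x Sx) => // Ax; have : (S `&` A) x by []; rewrite SA0.
have [a [Sa Aa] ale] := wA _ (@subIsetr _ S A) SA0.
have [SB0|/set0P SB0] := eqVneq (S `&` B) set0.
  exists a => // x Sx; case: (SAB x Sx) => [Ax|Bx]; first exact: ale.
  by have : (S `&` B) x by []; rewrite SB0.
have [b [Sb Bb] ble] := wB _ (@subIsetr _ S B) SB0.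
exists (Num.min a b) => [|x Sx]; first by rewrite minEle; case: ifP.
by rewrite ge_min; case: (SAB x Sx) => [Ax|Bx]; apply/orP;
  [left; apply: ale|right; apply: ble].
Qed.

Arguments well_orderedU {A B} _ _.

Lemma hahn0_wo : well_ordered [set g | (fun=> 0 : K) (g : rat) != 0].
Proof. by move=> S S0 [x /S0] /=; rewrite eqxx. Qed.

Definition hahn0 : hahn := Hahn hahn0_wo.

Lemma hahn_opp_wo (f : hahn) : well_ordered [set g | - f g != 0].
Proof. by apply: (well_orderedS _ (hahn_wo f)) => g /=; rewrite oppr_eq0. Qed.

Arguments hahn_opp_wo : clear implicits.
Definition hahn_opp (f : hahn) : hahn := Hahn (hahn_opp_wo f).

Lemma hahn_add_wo (f1 f2 : hahn) : well_ordered [set g | f1 g + f2 g != 0].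
Proof.
apply: (well_orderedS _ (well_orderedU (hahn_wo f1) (hahn_wo f2))) => g /= fg0.
have [f1g|] := eqVneq (f1 g) 0; last by left.
by right; rewrite f1g add0r in fg0.
Qed.

Arguments hahn_add_wo : clear implicits.
Definition hahn_add (f1 f2 : hahn) : hahn := Hahn (hahn_add_wo f1 f2).

Lemma hahn_addA : associative hahn_add.
Proof. by move=> f g h; apply: hahnP => x; apply: addrA. Qed.
Lemma hahn_addC : commutative hahn_add.
Proof. by move=> f g; apply: hahnP => x; apply: addrC. Qed.
Lemma hahn_add0 : left_id hahn0 hahn_add.
Proof. by move=> f; apply: hahnP => x; apply: add0r. Qed.
Lemma hahn_addN : left_inverse hahn0 hahn_opp hahn_add.
Proof. by move=> f; apply: hahnP => x; apply: addNr. Qed.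

HB.instance Definition _ := GRing.isZmodule.Build hahn
  hahn_addA hahn_addC hahn_add0 hahn_addN.

Lemma hcoef0 x : (0 : hahn) x = 0. Proof. by []. Qed.
Lemma hcoefD (f g : hahn) x : (f + g) x = f x + g x. Proof. by []. Qed.
Lemma hcoefN (f : hahn) x : (- f) x = - f x. Proof. by []. Qed.
Lemma hcoef_sum (J : Type) (r : seq J) (P : pred J) (F : J -> hahn) x :
  (\sum_(i <- r | P i) F i) x = \sum_(i <- r | P i) F i x.
Proof. exact: (big_morph (fun f : hahn => f x) (fun f g => hcoefD f g x)). Qed.

Lemma hahn_mul_finite (f1 f2 : hahn) g :
  finite_set [set a | f1 a * f2 (g - a) != 0].
Proof.
have := well_ordered_add_finite g (hahn_wo f1) (hahn_wo f2).
apply: sub_finite_set => a /=.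
by rewrite mulf_eq0 negb_or => /andP[].
Qed.

Definition hahn_mul_fun (f1 f2 : hahn) (g : rat) : K :=
  \sum_(a \in [set: rat]) f1 a * f2 (g - a).

Lemma hahn_mul_wo (f1 f2 : hahn) :
  well_ordered [set g | hahn_mul_fun f1 f2 g != 0].
Proof.
apply: (well_orderedS _ (well_ordered_add (hahn_wo f1) (hahn_wo f2))) => g /=.
move=> /(@fsbigN1 K 0 +%R _ _ _ (fun _ a => f1 a * f2 (g - a)) tt)[a _].
by rewrite mulf_eq0 negb_or => /andP[]; exists a.
Qed.

Arguments hahn_mul_wo : clear implicits.
Definition hahn_mul (f1 f2 : hahn) : hahn := Hahn (hahn_mul_wo f1 f2).

Lemma hahn_mono_wo (c : K) (g : rat) :
  well_ordered [set x | (if x == g then c else 0) != 0].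
Proof.
move=> S Sg [x Sx]; exists x => // y Sy.
have eg z : S z -> z = g by move=> /Sg /=; case: (eqVneq z g); rewrite ?eqxx.
by rewrite (eg x) // (eg y).
Qed.

Arguments hahn_mono_wo : clear implicits.
(* c z^g *)
Definition hahn_mono (c : K) (g : rat) : hahn := Hahn (hahn_mono_wo c g).

Lemma hahn_mulC : commutative hahn_mul.
Proof.
move=> f g; apply: hahnP => x; rewrite /= /hahn_mul_fun.
rewrite (@reindex_fsbigT _ _ _ _ _ (fun a => x - a)) /=; last first.
  by exists (fun a => x - a) => a; rewrite subKr.
by apply: eq_fsbigr => a _; rewrite subKr mulrC.
Qed.

Lemma fsum_exchange (F : rat -> rat -> K) :
  finite_set [set ab : rat * rat | F ab.1 ab.2 != 0] ->
  \sum_(a \in [set: rat]) \sum_(b \in [set: rat]) F a b =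
  \sum_(b \in [set: rat]) \sum_(a \in [set: rat]) F a b.
Proof.
move=> finF; set P := [set ab | _] in finF.
have fin1 := finite_image fst finF; have fin2 := finite_image snd finF.
have F1 a b : ~ (fst @` P) a -> F a b = 0.
  by move=> na; apply: contra_notP na => /eqP Fab; exists (a, b).
have F2 a b : ~ (snd @` P) b -> F a b = 0.
  by move=> nb; apply: contra_notP nb => /eqP Fab; exists (a, b).
transitivity (\sum_(a \in fst @` P) \sum_(b \in snd @` P) F a b).
  rewrite -(@fsbig_widen _ _ _ _ (fst @` P)) //.
    apply: eq_fsbigr => a _; rewrite -(@fsbig_widen _ _ _ _ (snd @` P)) //.
    by move=> b [_ nb] /=; apply: F2.
  by move=> a [_ na] /=; apply: fsbig1 => b _; apply: F1.
rewrite exchange_fsbig //.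
rewrite -[RHS](@fsbig_widen _ _ _ _ (snd @` P)) //.
  apply: eq_fsbigr => b _; rewrite -[RHS](@fsbig_widen _ _ _ _ (fst @` P)) //.
  by move=> a [_ na] /=; apply: F1.
by move=> b [_ nb] /=; apply: fsbig1 => a _; apply: F2.
Qed.

Lemma hahn_mulA : associative hahn_mul.
Proof.
move=> f g h; apply: hahnP => x; rewrite /= /hahn_mul_fun /= /hahn_mul_fun.
pose F a b := f a * g (b - a) * h (x - b).
transitivity (\sum_(a \in [set: rat]) \sum_(b \in [set: rat]) F a b).
  apply: eq_fsbigr => a _; rewrite mulr_fsumr.
  rewrite (@reindex_fsbigT _ _ _ _ _ (fun b => b - a)) /=; last first.
    by exists (fun b => b + a) => b; rewrite ?addrK ?subrK.
  by apply: eq_fsbigr => b _; rewrite mulrA opprB addrA subrK.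
rewrite fsum_exchange; first by apply: eq_fsbigr => b _; rewrite mulr_fsuml.
have := well_ordered_add_finite x
  (well_ordered_add (hahn_wo f) (hahn_wo g)) (hahn_wo h).
set D := (D in finite_set D) => finD.
have := finite_setXR finD (fun b _ => hahn_mul_finite f g b).
move=> /(finite_image (fun ba => (ba.2, ba.1))); apply: sub_finite_set.
move=> [a b] /=; rewrite /F mulf_eq0 negb_or => /andP[fg hb].
exists (b, a) => //=; split=> //=; split=> //; exists a;
  by move: fg; rewrite mulf_eq0 negb_or => /andP[].
Qed.

Lemma hahn_mulDl : left_distributive hahn_mul hahn_add.
Proof.
move=> f g h; apply: hahnP => x; rewrite /= /hahn_mul_fun /=.
have fin1 := hahn_mul_finite f h x; have fin2 := hahn_mul_finite g h x.
have fin : finite_set ([set a | f a * h (x - a) != 0] `|`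
                       [set a | g a * h (x - a) != 0]) by rewrite finite_setU.
set D := _ `|` _ in fin.
have e1 a : ~ D a -> f a * h (x - a) = 0.
  by move=> nD; apply: contra_notP nD => /eqP; left.
have e2 a : ~ D a -> g a * h (x - a) = 0.
  by move=> nD; apply: contra_notP nD => /eqP; right.
have wid (F : rat -> K) : (forall a, ~ D a -> F a = 0) ->
    \sum_(a \in [set: rat]) F a = \sum_(a \in D) F a.
  by move=> F0; apply/esym/fsbig_widen => // a [_ /F0].
rewrite !wid //; last by move=> a nD; rewrite mulrDl e1 // e2 // addr0.
by rewrite -fsbig_split //; apply: eq_fsbigr => a _; rewrite mulrDl.
Qed.

Lemma hahn_mono_mulE c g (f : hahn) x :
  hahn_mul (hahn_mono c g) f x = c * f (x - g).
Proof.
rewrite /= /hahn_mul_fun -(@fsbig_widen _ _ _ _ [set g]) //.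
  by rewrite fsbig_set1 /= eqxx.
by move=> a [_ /= /eqP/negPf ->]; rewrite mul0r.
Qed.

Lemma hahn_mul1 : left_id (hahn_mono 1 0) hahn_mul.
Proof. by move=> f; apply: hahnP => x; rewrite hahn_mono_mulE mul1r subr0. Qed.

Lemma hahn_oner_neq0 : hahn_mono 1 0 != 0.
Proof.
apply/eqP => /(congr1 (fun f : hahn => f 0)) /= /eqP.
by rewrite oner_eq0.
Qed.

HB.instance Definition _ := GRing.Zmodule_isComNzRing.Build hahn
  hahn_mulA hahn_mulC hahn_mul1 hahn_mulDl hahn_oner_neq0.

Lemma hcoef1 x : (1 : hahn) x = if x == 0 then 1 else 0. Proof. by []. Qed.
Lemma hcoefM (f g : hahn) x :
  (f * g) x = \sum_(a \in [set: rat]) f a * g (x - a).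
Proof. by []. Qed.
Lemma hcoef_monoM c e (f : hahn) x : (hahn_mono c e * f) x = c * f (x - e).
Proof. exact: hahn_mono_mulE. Qed.

Lemma hcoefM_neq0 (f g : hahn) x : (f * g) x != 0 ->
  exists2 a, f a != 0 & g (x - a) != 0.
Proof.
rewrite hcoefM => /(@fsbigN1 K 0 +%R _ _ _ (fun _ a => f a * g (x - a)) tt).
by move=> [a _]; rewrite mulf_eq0 negb_or => /andP[]; exists a.
Qed.

Definition hahn_scale (c : K) (f : hahn) : hahn := hahn_mono c 0 * f.

Lemma hahn_scaleE c f x : hahn_scale c f x = c * f x.
Proof. by rewrite hcoef_monoM subr0. Qed.

Lemma hahn_scaleA a b f :
  hahn_scale a (hahn_scale b f) = hahn_scale (a * b) f.
Proof. by apply: hahnP => x; rewrite !hahn_scaleE mulrA. Qed.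
Lemma hahn_scale1 : left_id 1 hahn_scale.
Proof. by move=> f; apply: hahnP => x; rewrite !hahn_scaleE mul1r. Qed.
Lemma hahn_scaleDr : right_distributive hahn_scale +%R.
Proof. by move=> c f g; apply: mulrDr. Qed.
Lemma hahn_scaleDl f : {morph hahn_scale^~ f : a b / a + b}.
Proof.
by move=> a b; apply: hahnP => x; rewrite hcoefD !hahn_scaleE mulrDl.
Qed.

HB.instance Definition _ := GRing.Zmodule_isLmodule.Build K hahn
  hahn_scaleA hahn_scale1 hahn_scaleDr hahn_scaleDl.

Lemma hahn_scaleAl (c : K) (f g : hahn) : c *: (f * g) = c *: f * g.
Proof. exact: mulrA. Qed.

HB.instance Definition _ := GRing.Lmodule_isLalgebra.Build K hahn hahn_scaleAl.
HB.instance Definition _ := GRing.Lalgebra_isComAlgebra.Build K hahn.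

Lemma hcoefZ (c : K) (f : hahn) x : (c *: f) x = c * f x.
Proof. exact: hahn_scaleE. Qed.

Lemma hahn_geometric (u : hahn) (m : rat) :
  0 < m -> (forall x, u x != 0 -> m <= x) -> exists v : hahn, (1 - u) * v = 1.
Proof.
move=> m_gt0 um.
have uX n x : (u ^+ n) x != 0 -> m *+ n <= x.
  elim: n x => [|n IH] x.
    by rewrite expr0 hcoef1 mulr0n; have [-> //|] := eqVneq x 0; rewrite eqxx.
  rewrite exprS => /hcoefM_neq0[a /um ma /IH]; rewrite lerBrDl mulrS.
  by apply: le_trans; rewrite lerD2r.
pose G n := \sum_(i < n) u ^+ i.
pose N (x : rat) := Num.bound (x / m).
have Nlt x : x < m *+ N x.
  have [x0|x0] := leP 0 x; last first.
    by apply: lt_le_trans x0 _; rewrite mulrn_wge0 // ltW.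
  rewrite -mulr_natl -ltr_pdivrMr //.
  by apply: archi_boundP; rewrite divr_ge0 // ltW.
have GE n x y : x <= y -> y < m *+ n -> G n x = G (N x) x.
  move=> xy yn; have Gs k l : (k <= l)%N -> x < m *+ k -> G l x = G k x.
    move=> kl xk; rewrite /G !hcoef_sum -!(big_mkord xpredT (fun i => (u ^+ i) x)).
    rewrite (big_cat_nat (leq0n k) kl) /= [X in _ + X]big_nat.
    rewrite [X in _ + X]big1 ?addr0 // => i /andP[ki _].
    apply: contraTeq xk => /uX xi; rewrite -leNgt; apply: le_trans xi.
    by apply: ler_wpMn2l => //; apply: ltW.
  have [nN|/ltnW Nn] := leqP n (N x); last exact: Gs Nn (Nlt x).
  by rewrite -(Gs n (N x)) //; apply: le_lt_trans yn.
have v_wo : well_ordered [set x | G (N x) x != 0].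
  move=> S SG [s Ss].
  have [||t [St ts] tle] := hahn_wo (G (N s)) (S `&` [set x | x <= s]).
  - by move=> x [/SG /= + xs]; rewrite -(GE (N s) x s).
  - by exists s; split=> /=.
  exists t => // x Sx; have [xs|/ltW sx] := leP x s; first exact: tle.
  exact: le_trans sx.
exists (Hahn v_wo); apply: hahnP => x.
transitivity (((1 - u) * G (N x)) x).
  rewrite !hcoefM; apply: eq_fsbigr => a _ /=.
  have [a0|a0] := leP 0 a.
    by rewrite (GE (N x) _ x) // gerBl.
  have u0 : u a = 0.
    by apply: contraTeq a0 => /um /(lt_le_trans m_gt0) /ltW; rewrite leNgt.
  by rewrite u0 lt_eqF // subr0 !mul0r.
rewrite -[1 - u]opprB mulNr -subrX1 opprB hcoefD hcoefN.
suff -> : (u ^+ N x) x = 0 by rewrite subr0.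
by apply: contraTeq (Nlt x) => /uX; rewrite -leNgt.
Qed.

Lemma hahn_inv_exists (f : hahn) : exists g : hahn, f != 0 -> g * f = 1.
Proof.
have [->|f0] := eqVneq f 0; first by exists 0.
have [||s /= fs smin] := hahn_wo f [set x | f x != 0] => //.
  apply: contrapT => f00; case/eqP: f0; apply: hahnP => x.
  by apply: contra_notP f00 => /eqP fx; exists x.
pose w := hahn_mono (f s)^-1 (- s).
have wfE x : (w * f) x = (f s)^-1 * f (x + s) by rewrite hcoef_monoM opprK.
have u_gt0 x : (1 - w * f) x != 0 -> 0 < x.
  rewrite hcoefD hcoefN hcoef1 wfE; have [->|x0] := eqVneq x 0.
    by rewrite add0r mulVf // subrr eqxx.
  rewrite sub0r oppr_eq0 mulf_eq0 negb_or => /andP[_ /smin].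
  by rewrite lerDr le_eqVlt eq_sym (negPf x0).
have [m m_gt0 um] : exists2 m, 0 < m & forall x, (1 - w * f) x != 0 -> m <= x.
  have [u0|u0] := pselect ([set x | (1 - w * f) x != 0] !=set0).
    have [m /u_gt0 m_gt0 ml] := hahn_wo _ _ (@subset_refl _ _) u0.
    by exists m.
  by exists 1 => // x ux; case: u0; exists x.
have [v] := hahn_geometric m_gt0 um; rewrite subKr => wfv.
by exists (w * v) => _; rewrite mulrAC.
Qed.

Definition hahn_inv (f : hahn) : hahn :=
  if f == 0 then 0 else sval (cid (hahn_inv_exists f)).

Lemma hahn_mulVf (f : hahn) : f != 0 -> hahn_inv f * f = 1.
Proof.
by move=> f0; rewrite /hahn_inv; case: cid => g /= gf; rewrite ifN // gf.
Qed.

Lemma hahn_inv0 : hahn_inv 0 = 0.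
Proof. by rewrite /hahn_inv ifT. Qed.

HB.instance Definition _ := GRing.ComNzRing_isField.Build hahn
  hahn_mulVf hahn_inv0.

Lemma hahn_phi_wo (p : nat) (p_ge2 : (1 < p)%N) (f : hahn) :
  well_ordered [set g | f (g / p%:R) != 0].
Proof.
have p_gt0 : 0 < (p%:R : rat) by rewrite ltr0n ltnW.
move=> S Sf [s Ss].
have [||m [t St <-] mle] := hahn_wo f [set g | exists2 t, S t & t / p%:R = g].
- by move=> _ [t St <-]; apply: Sf.
- by exists (s / p%:R), s.
exists t => // x Sx; have := mle (x / p%:R).
by rewrite ler_pM2r ?invr_gt0 //; apply; exists x.
Qed.
Arguments hahn_phi_wo {p} p_ge2 f.

Definition hahn_phi (p : nat) (p_ge2 : (1 < p)%N) (f : hahn) : hahn :=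
  Hahn (hahn_phi_wo p_ge2 f).

Section PhiMorphism.

Variables (p : nat) (p_ge2 : (1 < p)%N).

Lemma hahn_phi_zmod : zmod_morphism (hahn_phi p_ge2).
Proof. by move=> f g; apply: hahnP. Qed.

Lemma hahn_phi_monoid : monoid_morphism (hahn_phi p_ge2).
Proof.
have p_neq0 : (p%:R : rat) != 0 by rewrite pnatr_eq0 -lt0n ltnW.
split=> [|f g]; apply: hahnP => x.
  by rewrite /= mulf_eq0 invr_eq0 (negPf p_neq0) orbF.
transitivity ((f * g) (x / p%:R)) => //; rewrite !hcoefM /=.
rewrite (@reindex_fsbigT _ _ _ _ _ (fun a => a / p%:R)) /=; last first.
  by exists (fun a => a * p%:R) => a; rewrite ?divfK ?mulfK.
by apply: eq_fsbigr => a _; rewrite mulrBl.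
Qed.

HB.instance Definition _ :=
  GRing.isZmodMorphism.Build hahn hahn (hahn_phi p_ge2) hahn_phi_zmod.
HB.instance Definition _ :=
  GRing.isMonoidMorphism.Build hahn hahn (hahn_phi p_ge2) hahn_phi_monoid.

Lemma hahn_phi_bij : bijective (hahn_phi p_ge2).
Proof.
have p_gt0 : 0 < (p%:R : rat) by rewrite ltr0n ltnW.
have p_neq0 := lt0r_neq0 p_gt0.
have wo (f : hahn) : well_ordered [set g | f (g * p%:R) != 0].
  move=> S Sf [s Ss].
  have [||m [t St <-] mle] := hahn_wo f [set g | exists2 t, S t & t * p%:R = g].
  - by move=> _ [t St <-]; apply: Sf.
  - by exists (s * p%:R), s.
  exists t => // x Sx; have := mle (x * p%:R).
  by rewrite ler_pM2r //; apply; exists x.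
exists (fun f => Hahn (@wo f)) => f; apply: hahnP => x /=.
  by rewrite mulfK.
by rewrite divfK.
Qed.

End PhiMorphism.

(* Matrices over hahn with entries in S, and an inverse with entries in S.  For
   S a subring this is GL_d(S), viewed inside GL_d(hahn). *)
Definition GL_over (S : set hahn) (d : nat) : set 'M[hahn]_d :=
  [set M | [/\ M \in unitmx, forall i j, S (M i j)
                             & forall i j, S (invmx M i j)]].

Definition hspan (G : set hahn) : set hahn :=
  [set f | exists n (c : 'I_n -> K) (g : 'I_n -> hahn),
     (forall i, G (g i)) /\ f = \sum_(i < n) c i *: g i].

End Hahn.

Arguments hahn_mono {K} c g.

Notation Qbar := algC.

(* The union over k >= 1 of Qbar((z^(1/k))), inside hahn Qbar. *)
Definition puiseux : set (hahn Qbar) :=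
  [set f | exists (k : nat) (n0 : int), (0 < k)%N /\
     forall g, f g != 0 -> exists2 n : int, n0 <= n & g = n%:~R / k%:R].

(* The union over k >= 1 of Qbar[z^(-1/k)], inside hahn Qbar. *)
Definition negpoly : set (hahn Qbar) :=
  [set f | exists (k : nat) (q : {poly Qbar}), (0 < k)%N /\
     f = \sum_(i < size q) hahn_mono q`_i (- (i%:R / k%:R))].

Record Lambda (t : nat) := MkLambda {
  La_alpha : 'I_t -> nat;
  La_lambda : 'I_t -> Qbar;
  La_a : 'I_t -> rat;
  La_lambda_neq0 : forall i, La_lambda i != 0;
  La_a_gt0 : forall i, 0 < La_a i }.

(* k_1 + ... + k_i *)
Definition psum (t : nat) (k : {ffun 'I_t -> nat}) (i : 'I_t) : nat :=
  (\sum_(j < t | (j <= i)%N) k j)%N.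

Definition xi_exponent (p t : nat) (w : Lambda t) (k : {ffun 'I_t -> nat}) : rat :=
  - \sum_(i < t) La_a w i / p%:R ^+ psum k i.

Definition xi_term (t : nat) (w : Lambda t) (k : {ffun 'I_t -> nat}) : Qbar :=
  \prod_(i < t) ((k i)%:R ^+ La_alpha w i * La_lambda w i ^+ psum k i).

(* A finite set, by xi_finite. *)
Definition xi_index (p t : nat) (w : Lambda t) (g : rat) :
    set {ffun 'I_t -> nat} :=
  [set k : {ffun 'I_t -> nat} |
     (forall i, (0 < k i)%N) /\ xi_exponent p w k = g].

Definition xi_fun (p t : nat) (w : Lambda t) (g : rat) : Qbar :=
  \sum_(k \in xi_index p w g) xi_term w k.

Section Xi.

Variables (p : nat) (p_ge2 : (1 < p)%N) (t : nat) (w : Lambda t).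

Lemma xi_asc (u : nat -> {ffun 'I_t -> nat}) : injective u ->
  exists m n, (m < n)%N /\ xi_exponent p w (u m) < xi_exponent p w (u n).
Proof.
move=> uI.
have [||h hlt hle] := @well_ordered_subseqs 'I_t (enum 'I_t)
  (fun i => range (fun n => n%:R)) (fun i n => (u n i)%:R).
- by move=> i; apply: well_ordered_nat => _ [n _ <-]; exists n.
- by move=> i n; exists (u n i).
exists (h 0%N), (h 1%N); split; first exact: hlt.
have le01 i : (u (h 0%N) i <= u (h 1%N) i)%N.
  by rewrite -(ler_nat rat); apply: hle; rewrite ?mem_enum.
have [i lti] : exists i, (u (h 0%N) i < u (h 1%N) i)%N.
  apply: contrapT => nlt; have : h 0%N = h 1%N.
    apply: uI; apply/ffunP => i; apply/eqP; rewrite eqn_leq le01 leqNgt /=.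
    by apply/negP => lti; apply: nlt; exists i.
  by apply/eqP; rewrite ltn_eqF //; apply: hlt.
have ple j : (psum (u (h 0%N)) j <= psum (u (h 1%N)) j)%N by apply: leq_sum.
have plt : (psum (u (h 0%N)) i < psum (u (h 1%N)) i)%N.
  rewrite /psum (bigD1 i) //= [X in (_ < X)%N](bigD1 i) //= -addSn leq_add //.
  by apply: leq_sum.
have p_gt0 : 0 < (p%:R : rat) by rewrite ltr0n ltnW.
have p_gt1 : 1 < (p%:R : rat) by rewrite ltr1n.
rewrite /xi_exponent ltrN2 (bigD1 i) //= [X in _ < X](bigD1 i) //= ltr_leD //.
  rewrite ltr_pM2l ?La_a_gt0 // ltf_pV2 ?posrE ?exprn_gt0 //.
  by rewrite ltr_eXn2l.
apply: ler_sum => j _; rewrite ler_pM2l ?La_a_gt0 //.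
by rewrite lef_pV2 ?posrE ?exprn_gt0 // ler_eXn2l.
Qed.

Lemma xi_finite (g : rat) : finite_set (xi_index p w g).
Proof.
by apply: (asc_finite (P := [set k : {ffun 'I_t -> nat} | forall i, (0 < k i)%N])
  (e := xi_exponent p w)) => u uI _; apply: xi_asc.
Qed.

Lemma xi_wo : well_ordered [set g | xi_fun p w g != 0].
Proof.
have wo := asc_well_ordered (P := [set k : {ffun 'I_t -> nat} | forall i, (0 < k i)%N])
  (e := xi_exponent p w) (fun u uI _ => xi_asc uI).
apply: (well_orderedS _ wo) => g /= xi0.
have [k [kP kg] _] := @fsbigN1 Qbar 0 +%R _ _ _ (fun _ k => xi_term w k) tt xi0.
by exists k.
Qed.

End Xi.

Definition xi (p : nat) (p_ge2 : (1 < p)%N) (t : nat) (w : Lambda t) :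
  hahn Qbar := Hahn (@xi_wo p p_ge2 t w).

Lemma xi0 (p : nat) (p_ge2 : (1 < p)%N) (w : Lambda 0) : xi p_ge2 w = 1.
Proof.
apply: hahnP => g; rewrite hcoef1 /= /xi_fun.
have E k : xi_exponent p w k = 0 by rewrite /xi_exponent big_ord0 oppr0.
have [->|g0] := eqVneq g 0.
  rewrite -(@fsbig_widen _ _ _ _ [set finfun (fun=> 0%N)]).
  - by rewrite fsbig_set1 /xi_term big_ord0.
  - by move=> k _; split=> // -[].
  - by move=> k [_ []]; apply/ffunP => -[].
by apply: fsbig1 => k /= []; rewrite E => _ e; rewrite -e eqxx in g0.
Qed.

(* The element 1 is removed from these generators in V_space; for t = 0 the
   series xi is 1 (xi0), so no case distinction on t is needed. *)
Definition V_gen (p : nat) (p_ge2 : (1 < p)%N) (s : nat) : set (hahn Qbar) :=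
  [set f | exists g t (w : Lambda t),
     [/\ 0 <= g, (t <= s)%N & f = hahn_mono 1 (- g) * xi p_ge2 w]].

Definition V_space (p : nat) (p_ge2 : (1 < p)%N) (s : nat) : set (hahn Qbar) :=
  hspan (V_gen p_ge2 s `\ 1).

(* Block (i, j) of M for the block sizes r; the cast only makes the dimension
   d = \sum_i r i syntactically a sum, as submxblock requires. *)
Definition mxblk (R : Type) (d sigma : nat) (r : 'I_sigma -> nat)
    (rd : (d = \sum_(i < sigma) r i)%N) (M : 'M[R]_d) (i j : 'I_sigma) :
    'M[R]_(r i, r j) :=
  submxblock (castmx (rd, rd) M) i j.

Definition block_upper (R : nmodType) (d sigma : nat) (r : 'I_sigma -> nat)
    (rd : (d = \sum_(i < sigma) r i)%N) (M : 'M[R]_d) : Prop :=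
  forall i j : 'I_sigma, (j < i)%N -> mxblk rd M i j = 0.

Definition frakV (p : nat) (p_ge2 : (1 < p)%N) (d sigma : nat)
    (r : 'I_sigma -> nat) (rd : (d = \sum_(i < sigma) r i)%N) :
    set 'M[hahn Qbar]_d :=
  [set M | [/\ M \in unitmx, block_upper rd M,
     forall i, mxblk rd M i i = 1%:M &
     forall i j : 'I_sigma, (i < j)%N ->
       forall a b, V_space p_ge2 (j - i) (mxblk rd M i j a b)]].

Definition constmx (d : nat) (C : 'M[Qbar]_d) : 'M[hahn Qbar]_d :=
  map_mx (in_alg (hahn Qbar)) C.

Definition phimx (p : nat) (p_ge2 : (1 < p)%N) (d : nat)
    (M : 'M[hahn Qbar]_d) : 'M[hahn Qbar]_d :=
  map_mx (hahn_phi p_ge2) M.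

(* Main.v *)
(* The blocks can all be taken of size 1: a triangular system is enough.

   Over the Puiseux field, let v_0 <> 0 and v_(i+1) = A^-1 phi(v_i).  The first
   dependence v_n = sum_(i < n) e_i v_i turns the condition A w = lam phi(w) on
   w = sum_(i < n) x_i v_i into one equation
     x = sum_(1 <= j <= n) lam^j b_j phi^j(x),   x = x_(n-1),
   which has a nonzero Puiseux solution for a suitable constant lam: twist by the
   first slope of the Newton polygon, take lam to be a root of the resulting
   characteristic polynomial, and determine the coefficients of x recursively, as
   phi expands positive exponents.  Induction makes A triangular with constant
   diagonal; the part with positive exponents of an off-diagonal entry is in the
   image of f |-> a f - c phi(f) for the same reason, so only a polynomial in
   z^(-1/k) remains.

   In the spaces V_s everything follows from
     phi(xi_w) = nu (sum_j binom(alpha_1, j) xi_(w, alpha_1 := j)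
                     + z^(-a_1) xi_(w')),
   where nu = prod lambda_i and w' drops the first index: it shows that V_s is
   stable under phi and that a f - c phi(f) = h is solvable in V_(s+1) for h in
   V_s, which yields F_2 entry by entry. *)

Require Import Defs.
From HB Require Import structures.
From mathcomp Require Import all_boot all_order all_algebra all_field.
From mathcomp Require Import perm finmap.
From mathcomp Require Import boolp classical_sets functions cardinality fsbigop.
From mathcomp Require Import zify ring lra.

Set Implicit Arguments.
Unset Strict Implicit.
Unset Printing Implicit Defensive.

Import Order.TTheory GRing.Theory Num.Theory.

Local Open Scope classical_set_scope.
Local Open Scope ring_scope.

(** * Series supported in a lattice *)

Lemma well_ordered_lattice (k : nat) (n : int) : (0 < k)%N ->
  well_ordered [set g : rat | exists2 m : int, n <= m & g = m%:~R / k%:R].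
Proof.
move=> k0 S Sn [s Ss].
pose P i := `[< S ((n + i%:Z)%:~R / k%:R) >].
have exP x : S x -> exists i : nat, P i /\ x = (n + i%:Z)%:~R / k%:R.
  move=> Sx; have [m nm xE] := Sn _ Sx.
  have mE : n + `|m - n|%N%:Z = m by lia.
  by exists `|m - n|%N; rewrite /P mE -xE; split=> //; apply/asboolP.
have exP' : exists i, P i by have [i []] := exP s Ss; exists i.
case: (ex_minnP exP') => i /asboolP Si imin.
exists ((n + i%:Z)%:~R / k%:R) => // x /exP[j [/imin ij ->]].
by rewrite ler_pM2r ?invr_gt0 ?ltr0n // ler_int lerD2l.
Qed.

Section LatticeSupport.

Variable K : fieldType.
Implicit Types (f g h : hahn K) (k : nat) (n m : int).

(** For fixed [k] these sets form a filtration by order, decreasing in [n], so that convergence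
    arguments can raise the order in steps of 1/k. *)
Definition psupp k n f : Prop :=
  forall x, f x != 0 -> exists2 m : int, n <= m & x = m%:~R / k%:R.

Lemma psupp0 k n : psupp k n 0.
Proof. by move=> x; rewrite hcoef0 eqxx. Qed.

Lemma psupp_le k n m f : n <= m -> psupp k m f -> psupp k n f.
Proof. by move=> nm fm x /fm[l ml ->]; exists l => //; apply: le_trans ml. Qed.

Lemma psuppD k n f g : psupp k n f -> psupp k n g -> psupp k n (f + g).
Proof.
move=> fn gn x; rewrite hcoefD.
have [->|f0 _] := eqVneq (f x) 0; [by rewrite add0r => /gn | exact: fn].
Qed.

Lemma psuppN k n f : psupp k n f -> psupp k n (- f).
Proof. by move=> fn x; rewrite hcoefN oppr_eq0 => /fn. Qed.

Lemma psuppB k n f g : psupp k n f -> psupp k n g -> psupp k n (f - g).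
Proof. by move=> fn /psuppN; apply: psuppD. Qed.

Lemma psuppZ k n c f : psupp k n f -> psupp k n (c *: f).
Proof. by move=> fn x; rewrite hcoefZ mulf_eq0 negb_or => /andP[_ /fn]. Qed.

Lemma psupp_sum k n (I : Type) (r : seq I) (F : I -> hahn K) :
  (forall i, psupp k n (F i)) -> psupp k n (\sum_(i <- r) F i).
Proof.
by move=> Fn; elim/big_ind: _ => //; [exact: psupp0 | exact: psuppD].
Qed.

Lemma psuppM k n m f g : psupp k n f -> psupp k m g -> psupp k (n + m) (f * g).
Proof.
move=> fn gm x /hcoefM_neq0[a /fn[i ni aE] /gm[j mj E]].
exists (i + j); first exact: lerD.
by rewrite intrD mulrDl -E -aE addrC subrK.
Qed.

Lemma psupp_mono k n m c : n <= m ->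
  psupp k n (hahn_mono c (m%:~R / k%:R) : hahn K).
Proof.
move=> nm x /=; case: (eqVneq x (m%:~R / k%:R)) => [-> _|]; last by rewrite eqxx.
by exists m.
Qed.

Lemma psupp1 k : psupp k 0 (1 : hahn K).
Proof. by have := @psupp_mono k 0 0 1 (lexx _); rewrite mul0r. Qed.

Lemma psupp_phi (p : nat) (p_ge2 : (1 < p)%N) k n f :
  psupp k n f -> psupp k (n * p%:Z) (hahn_phi p_ge2 f).
Proof.
have p_neq0 : (p%:R : rat) != 0 by rewrite pnatr_eq0 -lt0n ltnW.
move=> fn x /= /fn[m nm E]; exists (m * p%:Z); first by rewrite ler_wpM2r.
by rewrite -[LHS](divfK p_neq0) E intrM mulrAC.
Qed.

Lemma psupp_refine k l n f : (0 < l)%N -> psupp k n f ->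
  psupp (k * l) (n * l%:Z) f.
Proof.
move=> l0 fn x /fn[m nm ->]; exists (m * l%:Z); first by rewrite ler_wpM2r.
by rewrite intrM natrM -mulf_div divff ?mulr1 // pnatr_eq0 -lt0n.
Qed.

Lemma psupp_gt k n f : psupp k n f -> f (n%:~R / k%:R) = 0 -> psupp k (n + 1) f.
Proof.
move=> fn f0 x fx; have [m nm xE] := fn _ fx; exists m => //.
rewrite lezD1 lt_neqAle nm andbT; apply: contraNneq fx => nE.
by rewrite xE -nE f0.
Qed.

Lemma psupp_eq0 k n f : (0 < k)%N -> (forall i : nat, psupp k (n + i%:Z) f) ->
  f = 0.
Proof.
move=> k0 fn; apply: hahnP => x; apply/eqP; apply: contrapT => /negP fx.
have [m _ xE] := fn 0%N _ fx.
have [m'] := fn `|m - n|.+1%N _ fx.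
rewrite {}xE => + /(mulIf _); rewrite invr_eq0 pnatr_eq0 -lt0n k0.
by move=> + /(_ isT)/intr_inj mE; rewrite -mE; lia.
Qed.

(* Coefficientwise limit: the n-th iterate fixes the coefficients below n. *)
Lemma hahn_fixpoint k n h (T : hahn K -> hahn K) : (0 < k)%N ->
  zmod_morphism T -> psupp k n h ->
  (forall m f, n <= m -> psupp k m f -> psupp k (m + 1) (T f)) ->
  exists2 y, psupp k n y & y = h + T y.
Proof.
move=> k0 TB hn Tn.
have T0 : T 0 = 0 by have := TB 0 0; rewrite !subrr.
pose Y i := iter i (fun y => h + T y) 0.
have Yn i : psupp k n (Y i).
  elim: i => [|i IH] /=; first exact: psupp0.
  apply: psuppD => //; apply: psupp_le (Tn _ _ _ IH); lia.
have YS i : psupp k (n + i%:Z) (Y i.+1 - Y i).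
  elim: i => [|i IH] /=; first by rewrite T0 !addr0 subr0.
  rewrite opprD addrACA subrr add0r -TB -[_.+1]addn1 PoszD addrA.
  by apply: Tn IH; lia.
have Ycauchy i j : (i <= j)%N -> psupp k (n + i%:Z) (Y j - Y i).
  move=> /subnKC <-; elim: (j - i)%N => [|l IH].
    by rewrite addn0 subrr; exact: psupp0.
  rewrite addnS -(subrK (Y (i + l)%N) (Y _.+1)) -addrA; apply: psuppD => //.
  by apply: psupp_le (YS _); lia.
have /choice[N NE] : forall x : rat, exists N,
    forall j, (N <= j)%N -> Y j x = Y N x.
  move=> x; have [[m nm xE]|nx] :=
      pselect (exists2 m : int, n <= m & x = m%:~R / k%:R).
    (* With [N] this index, later iterates differ from [Y N] only at numerators at least [n + N],
       which exceeds [m]. *)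
    exists `|m - n|.+1%N => j /Ycauchy Nj; apply/eqP; rewrite -subr_eq0.
    apply: contrapT => /negP /Nj[m'].
    rewrite xE => + /(mulIf _); rewrite invr_eq0 pnatr_eq0 -lt0n k0.
    by move=> + /(_ isT)/intr_inj mE; rewrite -mE; lia.
  exists 0%N => j _; rewrite hcoef0; apply/eqP.
  by apply: contrapT => /negP /Yn; exact: nx.
pose y0 x := Y (N x) x.
have y_wo : well_ordered [set x | y0 x != 0].
  by apply: well_orderedS (well_ordered_lattice (n := n) k0) => x /Yn.
pose y : hahn K := Hahn y_wo.
have yY i : psupp k (n + i%:Z) (y - Y i).
  move=> x; rewrite hcoefD hcoefN /= /y0 -(NE x _ (leq_maxl _ i)).
  by move=> ?; apply: (Ycauchy i _ (leq_maxr (N x) i)).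
exists y; first by rewrite -[y]subr0; apply: psupp_le (yY 0%N); rewrite addr0.
apply/eqP; rewrite -subr_eq0; apply/eqP; apply: (psupp_eq0 (n := n) k0) => i.
(* Compared through the iterates, the defect of [y] is a difference of two series with numerators at
   least [n + i], for every [i], so it vanishes. *)
have -> : y - (h + T y) = (y - Y i.+1) - T (y - Y i).
  by rewrite TB /=; ring.
apply: psuppB; first by apply: psupp_le (yY i.+1); lia.
by apply: psupp_le (Tn _ _ _ (yY i)); lia.
Qed.

End LatticeSupport.

(** * The Puiseux field *)

Lemma hahn_valuation (K : fieldType) (f : hahn K) : f != 0 ->
  exists2 v : rat, f v != 0 & forall x, f x != 0 -> v <= x.
Proof.
move=> f0; apply: (@hahn_wo _ f [set x | f x != 0]) => //.
apply: contrapT => nf; case/eqP: f0.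
by apply: hahnP => x; apply: contra_notP nf => /eqP fx; exists x.
Qed.

Lemma hahn_monoM (K : fieldType) (c c' : K) (x x' : rat) :
  hahn_mono c x * hahn_mono c' x' = hahn_mono (c * c') (x + x').
Proof.
apply: hahnP => y; rewrite hcoef_monoM /= subr_eq [x' + x]addrC.
by case: eqP; rewrite ?mulr0.
Qed.

Lemma hahn_mono1 (K : fieldType) : hahn_mono (1 : K) 0 = 1.
Proof. by []. Qed.

Lemma puiseux_common (f g : hahn Qbar) : puiseux f -> puiseux g ->
  exists k n, [/\ (0 < k)%N, psupp k n f & psupp k n g].
Proof.
move=> [k [n [k0 fn]]] [l [m [l0 gm]]].
exists (k * l)%N, (Num.min (n * l%:Z) (m * k%:Z)); split.
- by rewrite muln_gt0 k0.
- by apply: psupp_le (psupp_refine l0 fn); rewrite ge_min lexx.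
- rewrite mulnC; apply: psupp_le (psupp_refine k0 gm).
  by rewrite ge_min lexx orbT.
Qed.

Lemma puiseux1 : puiseux 1.
Proof. by exists 1%N, 0; split=> //; apply: psupp1. Qed.

Lemma puiseuxB (f g : hahn Qbar) : puiseux f -> puiseux g -> puiseux (f - g).
Proof.
move=> pf pg; have [k [n [k0 fn gn]]] := puiseux_common pf pg.
by exists k, n; split=> //; apply: psuppB.
Qed.

Lemma puiseuxM (f g : hahn Qbar) : puiseux f -> puiseux g -> puiseux (f * g).
Proof.
move=> pf pg; have [k [n [k0 fn gn]]] := puiseux_common pf pg.
by exists k, (n + n); split=> //; apply: psuppM.
Qed.

Lemma puiseux_mono c (x : rat) : puiseux (hahn_mono c x).
Proof.
exists `|denq x|%N, (numq x); split; first by rewrite absz_gt0 denq_neq0.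
move=> y; rewrite /=; case: (eqVneq y x) => [-> _|]; last by rewrite eqxx.
exists (numq x) => //; rewrite -{1}(divq_num_den x); congr (_ / _).
by rewrite -[in LHS]absz_denq.
Qed.

(** Dividing by the leading term leaves [1 - u] with [u] of positive order in the same lattice. The
    geometric series is the fixed point of [y = 1 + u * y], and [hahn_fixpoint] keeps its support in
    that lattice. *)
Lemma puiseuxV (f : hahn Qbar) : puiseux f -> puiseux f^-1.
Proof.
move=> pf; have [->|f0] := eqVneq f 0.
  by rewrite invr0 -(subrr 1); apply: puiseuxB; apply: puiseux1.
have [k [n [k0 fn]]] := pf.
have [v fv vmin] := hahn_valuation f0; have [m nm vE] := fn _ fv.
have fm : psupp k m f.
  move=> x fx; have [l nl xE] := fn _ fx; exists l => //.
  move: (vmin _ fx); rewrite vE xE ler_pM2r ?invr_gt0 ?ltr0n //.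
  by rewrite ler_int.
pose w := hahn_mono (f v)^-1 (- v); pose u := 1 - w * f.
have u1 : psupp k 1 u.
  rewrite -[1]add0r; apply: psupp_gt.
    apply: psuppB; first exact: psupp1.
    rewrite -(addNr m); apply: psuppM => //.
    by rewrite /w vE -mulNr -intrN; apply: psupp_mono.
  rewrite mul0r hcoefD hcoefN hcoef1 eqxx hcoef_monoM sub0r opprK.
  by rewrite mulVf // subrr.
have [|l g l0 gl|y y0 yE] :=
    hahn_fixpoint (T := fun g => u * g) k0 _ (@psupp1 _ k).
- by move=> g h; rewrite mulrBr.
- by rewrite addrC; apply: psuppM.
have wyf : w * y * f = 1.
  by rewrite mulrAC -[w * f](subKr 1) -/u mulrBl mul1r {1}yE addrK.
have -> : f^-1 = w * y by rewrite -[RHS](mulfK f0) wyf mul1r.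
apply: puiseuxM; first exact: puiseux_mono.
by exists k, 0.
Qed.

Definition puiseux_pred : {pred hahn Qbar} := fun f => `[< puiseux f >].

Lemma puiseux_divring_closed : divring_closed puiseux_pred.
Proof.
split=> [|f g /asboolP pf /asboolP pg|f g /asboolP pf /asboolP pg];
  apply/asboolP.
- exact: puiseux1.
- exact: puiseuxB.
- by apply: puiseuxM => //; apply: puiseuxV.
Qed.

HB.instance Definition _ :=
  GRing.isDivringClosed.Build (hahn Qbar) puiseux_pred puiseux_divring_closed.

(** A field type rather than a predicate: ranks and linear dependence are then taken over the
    Puiseux field, and the coefficients of a dependence are Puiseux series. *)
Record puis := Puis { pval :> hahn Qbar; pvalP : pval \in puiseux_pred }.

HB.instance Definition _ := [isSub for pval].
HB.instance Definition _ := [Choice of puis by <:].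
HB.instance Definition _ := [SubChoice_isSubIntegralDomain of puis by <:].
HB.instance Definition _ := [SubIntegralDomain_isSubField of puis by <:].

Lemma puisP (f : puis) : puiseux (pval f).
Proof. exact/asboolP/pvalP. Qed.

Lemma mkpuis (f : hahn Qbar) : puiseux f -> exists f' : puis, pval f' = f.
Proof. by move=> /asboolP pf; exists (Puis pf). Qed.

Lemma pval0 : pval 0 = 0. Proof. by []. Qed.

Lemma pvalD (f g : puis) : pval (f + g) = pval f + pval g.
Proof. by []. Qed.

Lemma pvalN (f : puis) : pval (- f) = - pval f.
Proof. by []. Qed.

Lemma pvalB (f g : puis) : pval (f - g) = pval f - pval g.
Proof. by []. Qed.

Lemma pvalM (f g : puis) : pval (f * g) = pval f * pval g.
Proof. by []. Qed.

Lemma pval_sum (I : Type) (r : seq I) (P : pred I) (F : I -> puis) :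
  pval (\sum_(i <- r | P i) F i) = \sum_(i <- r | P i) pval (F i).
Proof. exact: (raddf_sum val). Qed.

Lemma pvalX (f : puis) n : pval (f ^+ n) = pval f ^+ n.
Proof. exact: (rmorphXn val). Qed.

Lemma pval_inj : injective pval.
Proof. exact: val_inj. Qed.

Section PhiPuiseux.

Variables (p : nat) (p_ge2 : (1 < p)%N).

Lemma puiseux_phi (f : hahn Qbar) : puiseux f -> puiseux (hahn_phi p_ge2 f).
Proof.
by move=> [k [n [k0 fn]]]; exists k, (n * p%:Z); split=> //; apply: psupp_phi.
Qed.

Lemma phip_subproof (f : puis) : hahn_phi p_ge2 (pval f) \in puiseux_pred.
Proof. exact/asboolP/puiseux_phi/puisP. Qed.

Definition phip (f : puis) : puis := Puis (phip_subproof f).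

Lemma pval_phip f : pval (phip f) = hahn_phi p_ge2 (pval f).
Proof. by []. Qed.

Lemma phip_zmod : zmod_morphism phip.
Proof.
by move=> f g; apply: pval_inj; rewrite pvalB !pval_phip pvalB rmorphB.
Qed.

Lemma phip_monoid : monoid_morphism phip.
Proof.
split=> [|f g]; apply: pval_inj; first exact: rmorph1.
by rewrite pvalM !pval_phip pvalM rmorphM.
Qed.

HB.instance Definition _ := GRing.isZmodMorphism.Build puis puis phip phip_zmod.
HB.instance Definition _ :=
  GRing.isMonoidMorphism.Build puis puis phip phip_monoid.

End PhiPuiseux.

(** * Scalar Mahler equations *)

Section MahlerEquation.

Variables (p : nat) (p_ge2 : (1 < p)%N).
Local Notation phi := (@hahn_phi Qbar p p_ge2).
Implicit Types (f g : hahn Qbar).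

Lemma phiM f g : phi (f * g) = phi f * phi g.
Proof. exact: rmorphM. Qed.

Lemma phi_mono (c : Qbar) (x : rat) :
  phi (hahn_mono c x) = hahn_mono c (x * p%:R).
Proof.
have p_neq0 : (p%:R : rat) != 0 by rewrite pnatr_eq0 -lt0n ltnW.
by apply: hahnP => y /=; rewrite (can2_eq (divfK p_neq0) (mulfK p_neq0)).
Qed.

Lemma phiZ (c : Qbar) f : phi (c *: f) = c *: phi f.
Proof.
have E : phi (hahn_mono c 0) = hahn_mono c 0 by rewrite phi_mono mul0r.
by rewrite -[RHS]/(hahn_mono c 0 * phi f) -E -phiM.
Qed.

Lemma iter_phiD i : {morph iter i phi : f g / f + g}.
Proof. by elim: i => // i IH f g; rewrite !iterS IH rmorphD. Qed.

Lemma iter_phiB i : {morph iter i phi : f g / f - g}.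
Proof. by elim: i => // i IH f g; rewrite !iterS IH rmorphB. Qed.

Lemma iter_phiM i : {morph iter i phi : f g / f * g}.
Proof. by elim: i => // i IH f g; rewrite !iterS IH rmorphM. Qed.

Lemma iter_phi1 i : iter i phi 1 = 1.
Proof. by elim: i => // i IH; rewrite iterS IH rmorph1. Qed.

Lemma iter_phi_mono i (c : Qbar) (x : rat) :
  iter i phi (hahn_mono c x) = hahn_mono c (x * p%:R ^+ i).
Proof.
elim: i => [|i IH]; first by rewrite mulr1.
by rewrite iterS IH phi_mono exprSr mulrA.
Qed.

Lemma psupp_iter_phi i k (n : int) f : 0 <= n -> psupp k n f ->
  psupp k n (iter i phi f).
Proof.
move=> n0 fn; elim: i => //= i /(psupp_phi (p_ge2 := p_ge2)); apply: psupp_le.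
by rewrite ler_peMr // lez_nat ltnW.
Qed.

(** Since [p >= 2], [phi] moves a lower bound [n > 0] to at least [2 n >= n + 1]. This gain is what
    [hahn_fixpoint] asks for. *)
Lemma psupp_iter_phi_gt i k (n : int) f : 0 < n -> psupp k n f ->
  psupp k (n + 1) (iter i.+1 phi f).
Proof.
move=> n0 /(psupp_iter_phi (i := i) (ltW n0)) /(psupp_phi (p_ge2 := p_ge2)).
apply: psupp_le.
have : n * 2 <= n * p%:Z by rewrite ler_wpM2l // ltW.
by lia.
Qed.

Lemma puiseux_common_family n (b : 'I_n -> hahn Qbar) :
  (forall i, puiseux (b i)) ->
  exists2 k, (0 < k)%N & forall i, exists m, psupp k m (b i).
Proof.
move=> /choice[k kP].
exists (\prod_i k i)%N => [|i].
  by rewrite prodn_gt0 // => i; have [? []] := kP i.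
have [m [_ bm]] := kP i; rewrite (bigD1 i) //=.
eexists; apply: psupp_refine bm.
by rewrite prodn_gt0 // => j; have [? []] := kP j.
Qed.

(* Newton polygon: [- nu] is its first slope, so twisting by [z^nu] makes all the
   coefficients integral, with a nonconstant characteristic polynomial at
   [z = 0] whose constant term is 1. *)
Lemma mahler_equation_solution n (b : 'I_n -> hahn Qbar) :
  (forall i, puiseux (b i)) -> (exists i, b i != 0) ->
  exists lam x, [/\ lam != 0, puiseux x, x != 0 &
    x + \sum_(i < n) lam ^+ i.+1 *: (b i * iter i.+1 phi x) = 0].
Proof.
move=> pb [i0 bi0].
have /choice[v vP] : forall i, exists v : rat,
    b i != 0 -> b i v != 0 /\ forall x, b i x != 0 -> v <= x.
  move=> i; have [->|/hahn_valuation[v bv vmin]] := eqVneq (b i) 0.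
    by exists 0; rewrite eqxx.
  by exists v.
(* Substituting [x = z^nu y] and dividing by [z^nu] multiplies [b i] by [z^(q i * nu)]. The new
   valuation [v i + q i * nu] vanishes at [nu = s i], and the largest [s i] over the nonzero [b i]
   keeps all of them nonnegative. *)
pose q (i : 'I_n) : rat := p%:R ^+ i.+1 - 1.
have q_gt0 i : 0 < q i by rewrite subr_gt0 exprn_egt1 // ltr1n.
pose s i := - v i / q i.
have [i1 bi1 s_max] := @arg_maxP _ _ _ i0 (fun i => b i != 0) s bi0.
set nu := s i1 in s_max.
pose B i := b i * hahn_mono 1 (q i * nu).
have BE i x : B i x = b i (x - q i * nu) by rewrite /B mulrC hcoef_monoM mul1r.
have B_ge0 i x : B i x != 0 -> 0 <= x.
  rewrite BE => bx.
  have b0 : b i != 0 by apply: contraNneq bx => ->.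
  have := (vP i b0).2 _ bx; have : s i <= nu := s_max i b0.
  by rewrite [s i]/(- v i / q i) ler_pdivrMr // => + +; lra.
have B1_neq0 : B i1 0 != 0.
  rewrite BE sub0r /nu /s mulrC (divfK (lt0r_neq0 (q_gt0 i1))) opprK.
  exact: (vP i1 bi1).1.
have pB i : puiseux (B i) by apply: puiseuxM => //; apply: puiseux_mono.
have [k k0 kB] := puiseux_common_family pB.
have B0 i : psupp k 0 (B i).
  move=> x Bx; have [m Bm] := kB i; have [l ml xE] := Bm x Bx; exists l => //.
  by have := B_ge0 _ _ Bx; rewrite xE pmulr_lge0 ?invr_gt0 ?ltr0n // ler0z.
(* For [x = z^nu (1 + y)] with [y] of positive order, the twisted equation at [z^0] reads [chi.[lam]
   = 0]. *)
pose chi : {poly Qbar} := 1 + \sum_(i < n) B i 0 *: 'X^(i.+1).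
have chi1 : chi`_i1.+1 = B i1 0.
  rewrite coefD coef1 add0r coef_sum (bigD1 i1) //= big1 => [|i ne].
    by rewrite addr0 coefZ coefXn eqxx mulr1.
  rewrite coefZ coefXn eqSS; case: eqP => [/val_inj e|]; last by rewrite mulr0.
  by rewrite e eqxx in ne.
have chiE x : chi.[x] = 1 + \sum_(i < n) B i 0 * x ^+ i.+1.
  rewrite hornerD hornerC horner_sum; congr (_ + _).
  by apply: eq_bigr => i _; rewrite hornerZ hornerXn.
have /closed_rootP[lam /eqP chi_lam] : size chi != 1%N.
  apply: contraNneq B1_neq0 => sz; rewrite -chi1.
  by apply/eqP/(nth_default 0); rewrite sz.
have lam_neq0 : lam != 0.
  apply/eqP => l0; move: chi_lam; rewrite l0 chiE big1 => [/eqP|i _].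
    by rewrite addr0 oner_eq0.
  by rewrite expr0n mulr0.
(* The equation left for [y] is [y = h + T y]; the choice of [lam] removes the constant term of
   [h]. *)
pose h := - (1 + \sum_(i < n) lam ^+ i.+1 *: B i).
pose T y := - \sum_(i < n) lam ^+ i.+1 *: (B i * iter i.+1 phi y).
have h1 : psupp k 1 h.
  rewrite -[1]add0r; apply: psupp_gt.
    apply: psuppN; apply: psuppD; first exact: psupp1.
    by apply: psupp_sum => i; apply: psuppZ.
  rewrite mul0r hcoefN hcoefD hcoef1 eqxx hcoef_sum.
  have -> : 1 + \sum_(i < n) (lam ^+ i.+1 *: B i) 0 = chi.[lam].
    by rewrite chiE; congr (_ + _); apply: eq_bigr => i _; rewrite hcoefZ mulrC.
  by rewrite chi_lam oppr0.
have TB : zmod_morphism T.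
  move=> f g; rewrite /T -opprD -sumrB; congr (- _); apply: eq_bigr => i _.
  by rewrite iter_phiB mulrBr scalerBr.
have [m f m1 fm|y y1 yE] := hahn_fixpoint k0 TB h1.
  apply: psuppN; apply: psupp_sum => i; apply: psuppZ.
  by rewrite -[m + 1]add0r; apply: psuppM => //; apply: psupp_iter_phi_gt.
have mono_neq0 : hahn_mono (1 : Qbar) nu != 0.
  apply/eqP => /(congr1 (fun f : hahn Qbar => f nu)) /eqP.
  by rewrite /= eqxx oner_eq0.
exists lam, (hahn_mono 1 nu * (1 + y)); split=> //.
- apply: puiseuxM; first exact: puiseux_mono.
  exists k, 0; split=> //; apply: psuppD; first exact: psupp1.
  exact: psupp_le y1.
- rewrite mulf_neq0 //; apply/eqP => /(congr1 (fun f : hahn Qbar => f 0)).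
  rewrite hcoefD hcoef1 eqxx hcoef0.
  have -> : y 0 = 0.
    apply: contrapT => /eqP /y1[m m1 /eqP].
    rewrite eq_sym mulf_eq0 invr_eq0 pnatr_eq0 intr_eq0 (gtn_eqF k0) orbF.
    by move=> /eqP m0; rewrite m0 in m1.
  by move/eqP; rewrite addr0 oner_eq0.
- set M := hahn_mono 1 nu.
  set S1 := \sum_(i < n) lam ^+ i.+1 *: B i in h h1 yE.
  pose S2 := \sum_(i < n) lam ^+ i.+1 *: (B i * iter i.+1 phi y).
  have ME (i : 'I_n) : iter i.+1 phi (M * (1 + y)) =
      M * hahn_mono 1 (q i * nu) * (1 + iter i.+1 phi y).
    rewrite iter_phiM iter_phiD iter_phi1 iter_phi_mono hahn_monoM mulr1.
    have -> // : nu * p%:R ^+ i.+1 = nu + q i * nu.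
    by rewrite /q mulrBl mul1r addrC subrK mulrC.
  have ZE (Z : 'I_n -> hahn Qbar) :
      \sum_(i < n) lam ^+ i.+1 *:
        (b i * (M * hahn_mono 1 (q i * nu) * (1 + Z i)))
      = M * (S1 + \sum_(i < n) lam ^+ i.+1 *: (B i * Z i)).
    rewrite mulrDr !mulr_sumr -big_split /=; apply: eq_bigr => i _.
    rewrite -(scalerAr _ M (B i)) -(scalerAr _ M (B i * Z i)) -scalerDr /B.
    congr (_ *: _).
    by move: (b i) (Z i) (hahn_mono _ _); clear => *; ring.
  have -> : \sum_(i < n) lam ^+ i.+1 *: (b i * iter i.+1 phi (M * (1 + y))) =
            M * (S1 + S2).
    by rewrite /S2 -ZE; apply: eq_bigr => i _; rewrite ME.
  rewrite -mulrDr; have -> : 1 + y + (S1 + S2) = y - (h + T y).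
    by rewrite /h /T -/S2 opprD !opprK [1 + y]addrC -!addrA.
  by rewrite {1}yE subrr mulr0.
Qed.

End MahlerEquation.

(** * Triangularization over the Puiseux field *)

Lemma puiseux_const (c : Qbar) : c%:A \in puiseux_pred.
Proof.
apply/asboolP; have -> : c%:A = hahn_mono c 0 by rewrite -[RHS]mulr1.
exact: puiseux_mono.
Qed.

Definition pconst (c : Qbar) : puis := Puis (puiseux_const c).

Lemma pconst_zmod : zmod_morphism pconst.
Proof. by move=> a b; apply: pval_inj; rewrite pvalB /= scalerBl. Qed.

Lemma pconst_monoid : monoid_morphism pconst.
Proof.
split=> [|a b]; apply: pval_inj; first by rewrite /= scale1r.
by rewrite pvalM /= mulr_algl scalerA.
Qed.

HB.instance Definition _ :=
  GRing.isZmodMorphism.Build Qbar puis pconst pconst_zmod.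
HB.instance Definition _ :=
  GRing.isMonoidMorphism.Build Qbar puis pconst pconst_monoid.

Section Eigenvector.

Variables (p : nat) (p_ge2 : (1 < p)%N).
Local Notation phi := (phip p_ge2).

Lemma phip_const c : phi (pconst c) = pconst c.
Proof. by apply: pval_inj; rewrite /= phiZ rmorph1. Qed.

Lemma val_iter_phip i x : pval (iter i phi x) = iter i (hahn_phi p_ge2) (pval x).
Proof. by elim: i => //= i ->. Qed.

Lemma iter_phip_eq0 i x : (iter i phi x == 0) = (x == 0).
Proof. by elim: i => //= i IH; rewrite fmorph_eq0. Qed.

(** The shape that elimination produces: when [e] holds the coefficients of a dependence of length
    [m.+1], removing all unknowns but the last leaves this equation. *)
Lemma mahler_equation_puis m (e : nat -> puis) :
  (exists2 i, (i <= m)%N & e i != 0) ->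
  exists2 lam : Qbar, lam != 0 & exists2 x : puis, x != 0 &
    \sum_(j < m.+1) pconst lam ^+ j.+1 * iter j phi (e (m - j)%N) *
      iter j.+1 phi x = x.
Proof.
move=> [i im ei].
pose b (j : 'I_m.+1) := - pval (iter j phi (e (m - j)%N)).
have pb j : puiseux (b j) by rewrite /b -pvalN; apply: puisP.
have [|lam [x0 [lam0 /mkpuis[x <-] x_neq0 E]]] :=
    mahler_equation_solution p_ge2 pb.
  have lt : (m - i < m.+1)%N by rewrite ltnS leq_subr.
  exists (Ordinal lt); rewrite oppr_eq0 -pval0 (inj_eq pval_inj).
  by rewrite iter_phip_eq0 /= subKn.
exists lam => //; exists x; first by apply: contraNneq x_neq0 => ->.
apply: pval_inj; rewrite pval_sum; apply/eqP; rewrite eq_sym -subr_eq0.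
rewrite -{2}E -sumrN; apply/eqP; congr (_ + _); apply: eq_bigr => j _.
rewrite mulNr scalerN; congr (- _).
transitivity (lam%:A ^+ j.+1 *
    (pval (iter j phi (e (m - j)%N)) * pval (iter j.+1 phi x))).
  by rewrite 2!pvalM pvalX -mulrA.
by rewrite exprZn expr1n mulr_algl (val_iter_phip j.+1).
Qed.

(** A cyclic vector argument in row form, with [Phi(u) = phi(u) B]. On the iterates up to the first
    dependence, [Phi] acts through a companion matrix. *)
Lemma mahler_eigenvector d (B : 'M[puis]_d.+1) : B \in unitmx ->
  exists2 lam : Qbar, lam != 0 & exists2 w : 'rV[puis]_d.+1, w != 0 &
    pconst lam *: (map_mx phi w *m B) = w.
Proof.
move=> uB.
pose Phi (u : 'rV[puis]_d.+1) := map_mx phi u *m B.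
pose u n := iter n Phi (delta_mx 0 0).
pose U n : 'M_(n, d.+1) := \matrix_(i < n) u i.
have u_neq0 n : u n != 0.
  elim: n => [|n IH].
    by apply/eqP => /matrixP/(_ 0 0)/eqP; rewrite !mxE !eqxx oner_eq0.
  apply: contra_neq IH => /(congr1 (mulmxr (invmx B))) /=.
  rewrite mulmxK // mul0mx => /eqP; rewrite map_mx_eq0 => /eqP ->.
  by [].
have uS n : Phi (u n) = u n.+1 by [].
clearbody u.
have uU n i : (i < n)%N -> (u i <= U n)%MS.
  by move=> ltin; have := row_sub (Ordinal ltin) (U n); rewrite rowK.
have [n nU] : exists n, (u n <= U n)%MS.
  apply: contrapT => nex.
  (* Without a dependence each new iterate would raise the rank, which is at most [d.+1]. *)
  have rk n : (n <= \rank (U n))%N.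
    elim: n => // n IH; apply: leq_ltn_trans IH _.
    suff: (U n < U n.+1)%MS by rewrite ltmxErank => /andP[].
    rewrite /ltmx; apply/andP; split.
      by apply/row_subP => i; rewrite rowK; apply: uU; rewrite ltnS ltnW.
    apply/negP => le; apply: nex; exists n.
    by apply: submx_trans le; apply: uU.
  by have := leq_trans (rk d.+2) (rank_leq_col _); rewrite ltnn.
have exn : exists n, (u n <= U n)%MS by exists n.
case: (ex_minnP exn) => -[|m].
  by rewrite [U _]flatmx0 => /submx0null/eqP; rewrite (negPf (u_neq0 _)).
move=> /submxP[D uD] min.
pose e j := D 0 (inord j).
have uE : u m.+1 = \sum_(i < m.+1) e i *: u i.
  rewrite uD mulmx_sum_row; apply: eq_bigr => i _.
  by rewrite rowK /e inord_val.
have [|lam lam0 [x x0 xE]] := @mahler_equation_puis m e.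
  apply: contrapT => nex; case/eqP: (u_neq0 m.+1); rewrite uE big1 // => i _.
  have -> : e i = 0; last by rewrite scale0r.
  apply/eqP; apply: contrapT => /negP ei; apply: nex.
  by exists i; rewrite // -ltnS.
set L := pconst lam in xE; have phiL : phi L = L by apply: phip_const.
(* Comparing coefficients of [u i] in [lam Phi(w) = w] gives the recursion [X0], [XS]. This is its
   solution unrolled in terms of [x], and [xE] is the closing condition [X m = x]. *)
pose X i :=
  \sum_(j < i.+1) L ^+ j.+1 * iter j phi (e (i - j)%N) * iter j.+1 phi x.
have X0 : X 0%N = L * (e 0%N * phi x) by rewrite /X big_ord1 expr1 mulrA.
have XS i : X i.+1 = L * (e i.+1 * phi x + phi (X i)).
  rewrite /X big_ord_recl expr1 subn0 -mulrA mulrDr; congr (_ + _).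
  rewrite rmorph_sum mulr_sumr; apply: eq_bigr => j _.
  rewrite (rmorphM phi) (rmorphM phi) (rmorphXn phi) /= phiL 2!mulrA -exprS.
  by rewrite /bump /= add1n subSS.
exists lam => //; exists (\sum_(i < m.+1) X i *: u i).
  (* [X m = x] is nonzero, so [w = 0] would express [u m] by its predecessors, against the
     minimality of [m.+1]. *)
  apply/eqP => w0; have := min m; rewrite ltnn => /(_ _)/negP; apply=> //.
  have -> : u m = - (X m)^-1 *: \sum_(i < m) X i *: u i.
    have Xm : X m != 0 by rewrite /X xE.
    move: w0; rewrite big_ord_recr /= => /eqP.
    rewrite addrC addr_eq0 => /eqP/(congr1 (fun v => (X m)^-1 *: v)).
    by rewrite scalerA mulVf // scale1r scalerN scaleNr.
  apply: scalemx_sub; apply: summx_sub => i _; apply: scalemx_sub.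
  exact: uU.
rewrite -/L map_mx_sum mulmx_suml.
have PhiE i : map_mx phi (X i *: u i) *m B = phi (X i) *: u i.+1.
  by rewrite map_mxZ -scalemxAl [_ *m _]uS.
under eq_bigr do rewrite PhiE.
(* The top term [phi(X m) u m.+1] is rewritten by the dependence; the other terms are shifted by one
   index. *)
rewrite big_ord_recr /=.
rewrite [X in _ + X](_ : _ = phi x *: \sum_(i < m.+1) e i *: u i);
  last by rewrite -uE /= [X m]xE.
rewrite scaler_sumr.
rewrite [X in _ + X]big_ord_recl /= addrCA -big_split /= scalerDr scaler_sumr.
rewrite [RHS]big_ord_recl /= X0 2!scalerA; congr (_ + _).
  by rewrite -mulrA [phi x * _]mulrC.
apply: eq_bigr => i _.
by rewrite /bump /= add1n XS scalerA -scalerDl scalerA [phi x * _]mulrC addrC.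
Qed.

End Eigenvector.

(** [R j] looks only at values before [j], so they can be chosen in increasing order, with [x0]
    filling the places not yet reached. Triangular systems are solved column by column this way. *)
Lemma ord_rec_choice (X : Type) (x0 : X) n
    (R : 'I_n -> ('I_n -> X) -> X -> Prop) :
  (forall (j : 'I_n) f g x, (forall i : 'I_n, (i < j)%N -> f i = g i) ->
     R j f x -> R j g x) ->
  (forall (j : 'I_n) f, (forall i : 'I_n, (i < j)%N -> R i f (f i)) ->
     exists x, R j f x) ->
  exists f, forall j, R j f (f j).
Proof.
move=> Rext Rex.
suff /(_ n)[f fP] m : exists f, forall j : 'I_n, (j < m)%N -> R j f (f j).
  by exists f => j; apply: fP.
elim: m => [|m [f fP]]; first by exists (fun=> x0).
have [nm|mn] := leqP n m.
  by exists f => j _; apply: fP; apply: leq_trans nm.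
pose j0 := Ordinal mn; have [x Rx] := Rex j0 f fP.
exists (fun i => if i == j0 then x else f i) => j jm.
apply: (Rext j f) => [i ij|].
  rewrite ifN //; apply: contraTneq ij => ->.
  by rewrite -leqNgt -ltnS.
case: eqP => [->//|/eqP ne]; apply: fP.
by rewrite ltn_neqAle -ltnS jm andbT.
Qed.

Lemma sum_upper_col (R : pzRingType) n (T : 'M[R]_n) (g : 'I_n -> R) j :
  (forall i k : 'I_n, (k < i)%N -> T i k = 0) ->
  \sum_i g i * T i j = g j * T j j + \sum_(i < n | (i < j)%N) g i * T i j.
Proof.
move=> upT; rewrite (bigID (fun i : 'I_n => (i < j)%N)) /= addrC; congr (_ + _).
rewrite (bigD1 j) ?ltnn //= big1 ?addr0 // => i /andP[].
rewrite -leqNgt leq_eqVlt => /orP[/eqP/val_inj-> /eqP//|ji _].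
by rewrite upT ?mulr0.
Qed.

(** After a swap brings a nonzero entry to the front, the row on top of [(0 | 1)] is block
    triangular with that entry as determinant; [t] undoes the swap. *)
Lemma complete_row (F : fieldType) d (w : 'rV[F]_(1 + d)) : w != 0 ->
  exists2 P : 'M[F]_(1 + d), P \in unitmx & usubmx P = w.
Proof.
move=> /rV0Pn[i wi].
pose t := tperm_mx (lshift d 0) i : 'M[F]_(1 + d).
pose w' := xcol (lshift d 0) i w.
have w'E : lsubmx w' = (w 0 i)%:M.
  by apply/matrixP => a b; rewrite !ord1 !mxE tpermL eqxx mulr1n.
exists (block_mx (lsubmx w') (rsubmx w') 0 1%:M *m t).
  rewrite unitmx_mul unitmx_perm andbT unitmxE det_ublock w'E det1 mulr1.
  by rewrite det_scalar expr1 unitfE.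
rewrite -mul_usub_mx /block_mx col_mxKu hsubmxK /w' xcolE -/t -mulmxA.
by rewrite /t /tperm_mx -perm_mxM tperm2 perm_mx1 mulmx1.
Qed.

(** * Polynomials in z^(-1/k) *)

Lemma negpolyP (f : hahn Qbar) : negpoly f <->
  exists (k N : nat), (0 < k)%N /\
    forall x, f x != 0 -> exists2 m : nat, (m <= N)%N & x = - (m%:R / k%:R).
Proof.
split=> [[k [q [k0 ->]]]|[k [N [k0 fN]]]].
  exists k, (size q); split=> // x; rewrite hcoef_sum => fx.
  have [i] : exists i : 'I_(size q), hahn_mono q`_i (- (i%:R / k%:R)) x != 0.
    apply: contrapT => nex; case/eqP: fx; apply: big1 => i _; apply/eqP.
    by apply: contrapT => /negP ix; apply: nex; exists i.
  rewrite /=; case: (eqVneq x (- (i%:R / k%:R))) => [xE _|].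
    by exists i => //; apply: ltnW.
  by rewrite eqxx.
have kV0 : (k%:R : rat)^-1 != 0 by rewrite invr_eq0 pnatr_eq0 -lt0n.
have inj (i m : nat) :
    (- (m%:R / k%:R) == - (i%:R / k%:R) :> rat) = (i == m).
  by rewrite eqr_opp (inj_eq (mulIf kV0)) eqr_nat eq_sym.
exists k, (\poly_(i < N.+1) f (- (i%:R / k%:R))); split=> //.
set q := \poly_(i < _) _; apply: hahnP => x; rewrite hcoef_sum /=.
have [[m xE]|nx] := pselect (exists m : nat, x = - (m%:R / k%:R)); last first.
  rewrite big1 => [|i _]; last by case: eqP => // xE; case: nx; exists (val i).
  by apply/eqP; apply: contrapT => /negP /fN[m _ xE]; apply: nx; exists m.
rewrite {}xE; transitivity q`_m.
  rewrite coef_poly ltnS; case: leqP => // Nm; apply/eqP; apply: contrapT.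
  move=> /negP /fN[i iN /eqP]; rewrite inj => /eqP im.
  by move: Nm; rewrite -im ltnNge iN.
under eq_bigr do rewrite inj.
rewrite -big_mkcond (big_ord1_eq _ (fun i => q`_i)).
by case: ltnP => // /(nth_default 0).
Qed.

Lemma negpoly_const (c : Qbar) : negpoly c%:A.
Proof.
apply/negpolyP; exists 1%N, 0%N; split=> // x; rewrite hcoefZ hcoef1.
case: (eqVneq x 0) => [-> _|_]; last by rewrite mulr0 eqxx.
by exists 0%N; rewrite ?mul0r ?oppr0.
Qed.

Lemma negpoly0 : negpoly 0.
Proof. by rewrite -(scale0r 1); apply: negpoly_const. Qed.

Lemma hahn_restrict_wo (K : fieldType) (P : pred rat) (f : hahn K) :
  well_ordered [set x | (if P x then f x else 0) != 0].
Proof.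
apply: well_orderedS (@hahn_wo _ f) => x /=.
by case: ifP => //; rewrite eqxx.
Qed.

Definition hahn_restrict (K : fieldType) (P : pred rat) (f : hahn K) : hahn K :=
  Hahn (@hahn_restrict_wo K P f).

(** Between [n / k] and 0 the lattice has finitely many points, so the part with exponents at most
    0, constant term included, is a polynomial in [z^(-1/k)]. *)
Lemma puiseux_split (f : hahn Qbar) : puiseux f ->
  exists k (t g : hahn Qbar), [/\ (0 < k)%N, negpoly t, psupp k 1 g & f = t + g].
Proof.
move=> [k [n [k0 fn]]].
have kV : 0 < (k%:R : rat)^-1 by rewrite invr_gt0 ltr0n.
exists k, (hahn_restrict (fun x => x <= 0) f).
exists (hahn_restrict (fun x => 0 < x) f).
split=> //.
- apply/negpolyP; exists k, `|n|%N; split=> // x /=.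
  case: ifP => [x0 /fn[m nm xE]|]; last by rewrite eqxx.
  move: x0; rewrite xE pmulr_lle0 // lerz0 => m0.
  exists `|m|%N; first by lia.
  by rewrite -mulNr -[X in X%:~R]opprK intrN -{1}(ler0_norm m0) -abszE.
- move=> x /=; case: ifP => [x0 /fn[m nm xE]|]; last by rewrite eqxx.
  by exists m => //; move: x0; rewrite xE pmulr_lgt0 // ltr0z gtz0_ge1.
- apply: hahnP => x; rewrite hcoefD /= ltNge.
  by case: (x <= 0); rewrite ?addr0 ?add0r.
Qed.

Section Triangular.

Variables (p : nat) (p_ge2 : (1 < p)%N).
Local Notation phi := (phip p_ge2).

(** Only the part [g] of positive order is to be absorbed: [f = - a^-1 g + a^-1 c phi(f)] is a
    fixed-point equation for a map that raises positive orders. *)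
Lemma puiseux_scalar_reduction (a c : Qbar) (u : puis) : a != 0 ->
  exists f t : puis, negpoly (pval t) /\
    pconst a * f + u = t + phi f * pconst c.
Proof.
move=> a0; have [k [t [g [k0 nt g1 uE]]]] := puiseux_split (puisP u).
pose T (f : hahn Qbar) := (a^-1 * c) *: hahn_phi p_ge2 f.
have [|m f m1 fm|f f1 fE] :=
    @hahn_fixpoint _ k 1 (- a^-1 *: g) T k0 _ (psuppZ (c := - a^-1) g1).
- by move=> f h; rewrite /T rmorphB scalerBr.
- apply: psuppZ; apply: psupp_le (psupp_phi fm).
  have : m * 2 <= m * p%:Z by rewrite ler_wpM2l //; lia.
  by lia.
have /mkpuis[f' f'E] : puiseux f by exists k, 1.
have /mkpuis[g' g'E] : puiseux g by exists k, 1.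
have tE : pval (u - g') = t by rewrite pvalB g'E uE addrK.
exists f', (u - g'); rewrite tE; split=> //.
apply: pval_inj; rewrite (pvalD (_ * _)) (pvalD (u - g')).
rewrite (pvalM (pconst a)) (pvalM (phi f')) tE pval_phip f'E uE.
rewrite mulr_algl mulrC mulr_algl {1}fE scalerDr scaleNr scalerN /T !scalerA.
by rewrite divff // scale1r mulrA divff // mul1r addrC addrA addrK.
Qed.

(** As [T] is upper triangular, column [j] involves [f] only up to index [j]; the earlier terms are
    moved into [u] and the scalar case applies. *)
Lemma puiseux_row_reduction n (a : Qbar) (c : 'I_n -> Qbar) (T : 'M[puis]_n)
    (u : 'rV[puis]_n) : a != 0 ->
  (forall i j : 'I_n, (j < i)%N -> T i j = 0) ->
  (forall j, T j j = pconst (c j)) ->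
  exists f t : 'rV[puis]_n, (forall j, negpoly (pval (t 0 j))) /\
    pconst a *: f + u = t + map_mx phi f *m T.
Proof.
move=> a0 upT dT.
have [|j F _|F FP] := @ord_rec_choice (puis * puis) (0, 0) n
  (fun j F x => negpoly (pval x.2) /\
     pconst a * x.1 + u 0 j = x.2 + (phi x.1 * pconst (c j) +
       \sum_(i < n | (i < j)%N) phi (F i).1 * T i j)).
- move=> j f g x fg [nx E]; split=> //; rewrite E.
  by congr (_ + (_ + _)); apply: eq_bigr => i /fg ->.
- pose s := \sum_(i < n | (i < j)%N) phi (F i).1 * T i j.
  have [f [t [nt E]]] := @puiseux_scalar_reduction a (c j) (u 0 j - s) a0.
  exists (f, t); split=> //=; rewrite -/s; rewrite addrA in E.
  by rewrite addrA -E subrK.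
exists (\row_j (F j).1), (\row_j (F j).2); split=> [j|].
  by rewrite mxE; case: (FP j).
apply/rowP => j; rewrite !mxE (FP j).2 -dT -sum_upper_col //.
by congr (_ + _); apply: eq_bigr => i _; rewrite !mxE.
Qed.

(** Induction on the dimension: an eigenvector splits off the first basis vector, the induction
    hypothesis treats the remaining block, and [puiseux_row_reduction] makes the row beside it
    polynomial. *)
Lemma puiseux_triangularization d (A : 'M[puis]_d) : A \in unitmx ->
  exists (F Theta : 'M[puis]_d) (c : 'I_d -> Qbar),
    [/\ F \in unitmx, forall j, c j != 0,
        (forall i j : 'I_d, (j < i)%N -> Theta i j = 0) /\
        (forall j, Theta j j = pconst (c j)),
        forall i j, negpoly (pval (Theta i j)) &
        A *m F = map_mx phi F *m Theta].
Proof.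
elim: d A => [|d IH] A uA.
  exists 1%:M, A, (fun=> 0); split.
  - exact: unitmx1.
  - by case.
  - by split=> -[].
  - by case.
  - by rewrite map_mx1 mulmx1 mul1mx.
(* Transposition turns the row equation for [B = (A^-1)^T] into [A w^T = lam phi(w^T)]. *)
have uB : (invmx A)^T \in unitmx by rewrite unitmx_tr unitmx_inv.
have [lam lam0 [w w0 wE]] := mahler_eigenvector p_ge2 uB.
have [P uP PE] := @complete_row _ d w w0.
pose Q := P^T : 'M[puis]_(1 + d).
have uQ : Q \in unitmx by rewrite unitmx_tr.
have uphiQ : map_mx phi Q \in unitmx by rewrite map_unitmx.
have QE : lsubmx Q = w^T by rewrite -PE -trmx_usub.
have Aw : A *m w^T = pconst lam *: map_mx phi w^T.
  rewrite -{1}wE linearZ /= trmx_mul trmxK -scalemxAr mulmxA mulmxV //.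
  by rewrite mul1mx map_trmx.
(* The first column of [Q] is the eigenvector, so the first column of the transformed matrix is
   [lam] times the first unit vector. *)
pose N : 'M[puis]_(1 + d) := invmx (map_mx phi Q) *m (A *m Q).
have AQ : A *m Q = map_mx phi Q *m N by rewrite mulmxA mulmxV // mul1mx.
have Nl : lsubmx N = pconst lam *: lsubmx (1%:M : 'M_(1 + d)).
  rewrite -!mulmx_lsub QE Aw -scalemxAr -QE map_lsubmx mulmx_lsub.
  by rewrite mulVmx.
have NlE i : N i (lshift d 0) = pconst lam * (i == lshift d 0)%:R.
  by have /matrixP/(_ i 0) := Nl; rewrite !mxE.
have Nul : ulsubmx N = (pconst lam)%:M.
  by apply/matrixP => i j; rewrite !ord1 2!mxE NlE mxE !eqxx mulr1.
have Ndl : dlsubmx N = 0.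
  by apply/matrixP => i j; rewrite ord1 2!mxE NlE mxE eq_rlshift mulr0.
pose A' := drsubmx N.
have NE : N = block_mx (pconst lam)%:M (ursubmx N) 0 A'.
  by rewrite -{1}(submxK N) Nul Ndl.
have plam0 : pconst lam != 0 by rewrite fmorph_eq0.
have uN : N \in unitmx by rewrite unitmx_mul unitmx_inv uphiQ unitmx_mul uA.
have uA' : A' \in unitmx.
  move: uN; rewrite NE !unitmxE det_ublock !unitfE mulf_eq0 negb_or.
  by case/andP.
have [F [Theta [c [uF c0 [upT dT] nT FE]]]] := IH A' uA'.
have [f [t [nt fE]]] := puiseux_row_reduction (ursubmx N *m F) lam0 upT dT.
pose G : 'M[puis]_(1 + d) := block_mx 1%:M f 0 F.
pose Th : 'M[puis]_(1 + d) := block_mx (pconst lam)%:M t 0 Theta.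
have uG : G \in unitmx.
  by rewrite unitmxE det_ublock det1 mul1r -unitmxE.
(* The lower right block is the induction hypothesis [FE], the upper right one is [fE]. *)
have NG : N *m G = map_mx phi G *m Th.
  rewrite NE /G /Th map_block_mx map_mx1 map_mx0 !mulmx_block.
  rewrite !mulmx0 !mul0mx !mulmx1 !mul1mx !addr0 !add0r FE.
  by rewrite mul_scalar_mx fE.
pose c' (i : 'I_(1 + d)) := if fintype.split i is inr j then c j else lam.
have upTh (i j : 'I_(1 + d)) : (j < i)%N -> Th i j = 0.
  case: (split_ordP i) => i' ->; case: (split_ordP j) => j' ->;
    rewrite /Th ?block_mxEul ?block_mxEur ?block_mxEdl ?block_mxEdr.
  - by rewrite !ord1 ltnn.
  - by rewrite /= ltnNge ltnW // (leq_trans (ltn_ord i')) // leq_addr.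
  - by rewrite mxE.
  - by rewrite /= ltn_add2l => ij; apply: upT.
have dTh (i : 'I_(1 + d)) : Th i i = pconst (c' i).
  case: (split_ordP i) => i' ->; rewrite /Th ?block_mxEul ?block_mxEdr /c'.
    by rewrite mxE eqxx (unsplitK (inl i')).
  by rewrite dT (unsplitK (inr i')).
have nTh (i j : 'I_(1 + d)) : negpoly (Th i j).
  case: (split_ordP i) => i' ->; case: (split_ordP j) => j' ->;
    rewrite /Th ?block_mxEul ?block_mxEur ?block_mxEdl ?block_mxEdr //.
  - by rewrite mxE !ord1 eqxx mulr1n; apply: negpoly_const.
  - by rewrite ord1.
  - by rewrite mxE; apply: negpoly0.
exists (Q *m G), Th, c'; split=> //.
- by rewrite unitmx_mul uQ.
- by rewrite /c' => i; case: fintype.split.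
- by rewrite mulmxA AQ map_mxM -[LHS]mulmxA -[RHS]mulmxA NG.
Qed.

End Triangular.

(** * The series xi *)

Section LambdaCons.

Lemma Lambda_ext t (w w' : Lambda t) : La_alpha w =1 La_alpha w' ->
  La_lambda w =1 La_lambda w' -> La_a w =1 La_a w' -> w = w'.
Proof.
case: w w' => [al la a hla ha] [al' la' a' hla' ha'] /= /funext e1 /funext e2.
move=> /funext e3; subst; congr MkLambda; exact: Prop_irrelevance.
Qed.

Definition ocons (T : Type) t (x : T) (f : 'I_t -> T) (i : 'I_t.+1) : T :=
  if unlift ord0 i is Some j then f j else x.

Lemma ocons0 (T : Type) t (x : T) (f : 'I_t -> T) : ocons x f ord0 = x.
Proof. by rewrite /ocons unlift_none. Qed.

Lemma oconsS (T : Type) t (x : T) (f : 'I_t -> T) j :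
  ocons x f (lift ord0 j) = f j.
Proof. by rewrite /ocons liftK. Qed.

Lemma oconsP (T : Type) (P : T -> Prop) t (x : T) (f : 'I_t -> T) :
  P x -> (forall j, P (f j)) -> forall i, P (ocons x f i).
Proof. by move=> Px Pf i; rewrite /ocons; case: unlift. Qed.

Lemma ocons_eta (T : Type) t (f : 'I_t.+1 -> T) :
  ocons (f ord0) (fun j => f (lift ord0 j)) =1 f.
Proof. by move=> i; rewrite /ocons; case: unliftP => [j|] ->. Qed.

Variables (t : nat) (al : nat) (la : Qbar) (a : rat).
Hypotheses (la_neq0 : la != 0) (a_gt0 : 0 < a).

(** The new index goes in front: [k_1] occurs in every partial sum, so multiplying all exponents by
    [p] amounts to lowering [k_1] by one. The series are therefore peeled from the first index. *)
Definition Lcons (w : Lambda t) : Lambda t.+1 :=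
  MkLambda (ocons al (La_alpha w))
    (oconsP (P := fun x => x != 0) la_neq0 (@La_lambda_neq0 _ w))
    (oconsP (P := fun x => 0 < x) a_gt0 (@La_a_gt0 _ w)).

Definition fcons (n : nat) (k : {ffun 'I_t -> nat}) : {ffun 'I_t.+1 -> nat} :=
  [ffun i => ocons n k i].

Lemma psum_fcons0 n k : psum (fcons n k) ord0 = n.
Proof.
by rewrite /psum big_mkcond big_ord_recl /= ffunE ocons0 big1 ?addn0.
Qed.

Lemma psum_fconsS n k j : psum (fcons n k) (lift ord0 j) = (n + psum k j)%N.
Proof.
rewrite /psum big_mkcond big_ord_recl /= ffunE ocons0; congr (_ + _)%N.
rewrite [RHS]big_mkcond; apply: eq_bigr => i _.
by rewrite ffunE oconsS /bump !add1n ltnS.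
Qed.

Lemma xi_exponent_cons p w n k : xi_exponent p (Lcons w) (fcons n k) =
  (xi_exponent p w k - a) / p%:R ^+ n.
Proof.
rewrite /xi_exponent big_ord_recl psum_fcons0 /= ocons0 opprD addrC mulrBl.
congr (_ - _); rewrite mulNr; congr (- _); rewrite mulr_suml.
apply: eq_bigr => j _.
by rewrite psum_fconsS oconsS exprD invfM -mulrA [_^-1 * _]mulrC.
Qed.

Lemma xi_term_cons w n k : xi_term (Lcons w) (fcons n k) =
  n%:R ^+ al * (la * \prod_i La_lambda w i) ^+ n * xi_term w k.
Proof.
rewrite /xi_term big_ord_recl psum_fcons0 /= ffunE !ocons0.
under eq_bigr do rewrite psum_fconsS ffunE !oconsS exprD mulrCA.
by rewrite big_split /= exprMn -prodrXl !mulrA.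
Qed.

End LambdaCons.

Lemma LambdaS t (w : Lambda t.+1) :
  exists al la a (la0 : la != 0) (a0 : 0 < a) (w' : Lambda t),
    w = Lcons al la0 a0 w'.
Proof.
pose w' := MkLambda (fun j : 'I_t => La_alpha w (lift ord0 j))
  (fun j => La_lambda_neq0 w (lift ord0 j)) (fun j => La_a_gt0 w (lift ord0 j)).
exists (La_alpha w ord0), _, _, (La_lambda_neq0 w ord0), (La_a_gt0 w ord0), w'.
by apply: Lambda_ext => i; rewrite /= ocons_eta.
Qed.

Section XiCons.

Variables (p : nat) (p_ge2 : (1 < p)%N) (t : nat) (la : Qbar) (a : rat).
Variables (la0 : la != 0) (a0 : 0 < a) (w : Lambda t).
Local Notation nu := (la * \prod_i La_lambda w i).
Local Notation xc al := (xi p_ge2 (Lcons al la0 a0 w)).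

(** Summation over [k_1 = n.+1] first. Finitely many index vectors reach a given exponent, so every
    long enough truncation is exact. One bound serves all [al], because [phi_xi_cons] compares
    different powers. *)
Lemma xi_cons_coef (g : rat) : exists N, forall M, (N <= M)%N -> forall al,
  xc al g = \sum_(n < M) n.+1%:R ^+ al * nu ^+ n.+1 *
    xi p_ge2 w (g * p%:R ^+ n.+1 + a).
Proof.
have p_neq0 n : (p%:R : rat) ^+ n != 0.
  by rewrite expf_neq0 // pnatr_eq0 -lt0n ltnW.
(* The exponents do not involve [al], so [al = 0] gives the common index set. *)
pose A := xi_index p (Lcons 0 la0 a0 w) g.
have finA : finite_set A by apply: xi_finite.
exists (\max_(k <- fset_set A) k ord0)%N => M NM al.
have AM (k : {ffun 'I_t.+1 -> nat}) : A k -> (k ord0 <= M)%N.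
  move=> Ak; apply: leq_trans NM.
  by apply: (@leq_bigmax_seq _ _ xpredT
    (fun k : {ffun 'I_t.+1 -> nat} => k ord0));
    rewrite // in_fset_set // inE.
rewrite /= /xi_fun -/A.
pose F (n : nat) (k : {ffun 'I_t.+1 -> nat}) :=
  if k ord0 == n.+1 then xi_term (Lcons al la0 a0 w) k else 0.
transitivity (\sum_(k \in A) \sum_(n \in `I_M) F n k).
  apply: eq_fsbigr => k; rewrite inE => Ak.
  have k0 : (0 < k ord0)%N by case: Ak.
  rewrite -fsbig_ord /F -big_mkcond.
  rewrite (eq_bigl (fun n : 'I_M => val n == (k ord0).-1)); last first.
    by move=> n /=; rewrite -[RHS]eqSS prednK // eq_sym.
  rewrite (big_ord1_eq _ (fun=> xi_term (Lcons al la0 a0 w) k)) ifT //.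
  by rewrite prednK // AM.
rewrite exchange_fsbig // -fsbig_ord; apply: eq_bigr => n _.
pose J := [set k : {ffun 'I_t.+1 -> nat} | k ord0 = n.+1].
transitivity (\sum_(k \in A `&` J) xi_term (Lcons al la0 a0 w) k).
  rewrite [RHS]fsbig_mkcondr; apply: eq_fsbigr => k _; rewrite /F.
  by congr (if _ then _ else _); apply/eqP/idP; rewrite inE.
rewrite /= /xi_fun mulr_fsumr.
rewrite (@reindex_fsbig _ _ _ _ _ (fcons n.+1)
  (xi_index p w (g * p%:R ^+ n.+1 + a))).
  by apply: eq_fsbigr => k _; rewrite xi_term_cons.
split.
- move=> k [kpos kE]; split.
    split=> [i|]; first by rewrite ffunE; apply: (oconsP (P := leq 1)).
    by rewrite xi_exponent_cons kE addrK mulfK.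
  by rewrite /J /= ffunE ocons0.
- move=> k k' _ _ /ffunP E; apply/ffunP => j.
  by have := E (lift ord0 j); rewrite !ffunE !oconsS.
- move=> k [[kpos kE] Jk].
  pose k' := [ffun j => k (lift ord0 j)].
  have kk' : fcons n.+1 k' = k.
    apply/ffunP => i; rewrite ffunE -[RHS](ocons_eta k) Jk /ocons.
    by case: unlift => // j; rewrite ffunE.
  exists k' => //; split=> [j|]; first by rewrite ffunE.
  move: kE; rewrite -kk' xi_exponent_cons => <-.
  by rewrite divfK // subrK.
Qed.

(** [phi] shifts the summation over [k_1]: the first term becomes [nu z^(-a) xi_w], and in the
    others the power of [n.+2] is expanded binomially in powers of [n.+1]. *)
Lemma phi_xi_cons al : hahn_phi p_ge2 (xc al) =
  nu *: (\sum_(j < al.+1) 'C(al, j)%:R *: xc j + hahn_mono 1 (- a) * xi p_ge2 w).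
Proof.
have p_neq0 : (p%:R : rat) != 0 by rewrite pnatr_eq0 -lt0n ltnW.
apply: hahnP => g.
have [N1 E1] := xi_cons_coef (g / p%:R); have [N2 E2] := xi_cons_coef g.
pose M := maxn N1 N2.
(* One more term than at [g], for the summand that is split off below. *)
have {}E1 := E1 M.+1 (leqW (leq_maxl _ _)).
have {}E2 := E2 M (leq_maxr _ _).
pose X n := xi p_ge2 w (g * p%:R ^+ n + a).
transitivity (xc al (g / p%:R)) => //.
rewrite E1 hcoefZ hcoefD hcoef_monoM mul1r opprK hcoef_sum.
transitivity (\sum_(n < M.+1) n.+1%:R ^+ al * nu ^+ n.+1 * X n).
  apply: eq_bigr => n _; rewrite /X.
  by rewrite [_ / _ * _](_ : _ = g * p%:R ^+ n) // exprS mulrA divfK.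
rewrite big_ord_recl expr1n mul1r expr1.
rewrite [X ord0](_ : _ = xi p_ge2 w (g + a)); last first.
  by rewrite /X expr0 mulr1.
rewrite mulrDr [RHS]addrC; congr (_ + _).
rewrite [in RHS](eq_bigr (fun j : 'I_al.+1 => \sum_(n < M)
    'C(al, j)%:R * (n.+1%:R ^+ j * nu ^+ n.+1 * X n.+1))) => [|j _]; last first.
  by rewrite -mulr_sumr -E2; apply: hcoefZ.
rewrite exchange_big mulr_sumr; apply: eq_bigr => n _.
rewrite -[nat_of_ord (lift ord0 n)]/(n.+1) exprS -[n.+2%:R]natr1 exprD1n.
rewrite mulr_suml mulr_suml mulr_sumr.
apply: eq_bigr => j _; rewrite -/(X n.+1) -mulr_natl.
by move: (X _) (nu ^+ _) => x y; ring.
Qed.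

End XiCons.

(** * The spaces V_s and the equation c f - c' phi(f) = h *)

Section Span.

Variable K : fieldType.
Implicit Types (S G : set (hahn K)) (f g : hahn K).

Definition hsubspace S : Prop :=
  [/\ S 0, forall f g, S f -> S g -> S (f + g) & forall c f, S f -> S (c *: f)].

Lemma hsubspace_sum S (I : Type) (r : seq I) (P : pred I) (F : I -> hahn K) :
  hsubspace S -> (forall i, P i -> S (F i)) -> S (\sum_(i <- r | P i) F i).
Proof. by move=> [S0 SD _] SF; elim/big_ind: _. Qed.

Lemma hsubspaceB S f g : hsubspace S -> S f -> S g -> S (f - g).
Proof. by move=> [_ SD SZ] Sf Sg; rewrite -scaleN1r; apply/SD/SZ. Qed.

Lemma hspan_gen G f : G f -> hspan G f.
Proof.
move=> Gf; exists 1%N, (fun=> 1), (fun=> f); split=> //.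
by rewrite big_ord1 scale1r.
Qed.

Lemma hspan_subspace G : hsubspace (hspan G).
Proof.
split.
- by exists 0%N, (fun=> 0), (fun=> 0); split=> [[]|]; rewrite ?big_ord0.
- move=> _ _ [n [c [f [Gf ->]]]] [m [b [g [Gg ->]]]].
  exists (n + m)%N,
    (fun i => match fintype.split i with inl j => c j | inr j => b j end),
    (fun i => match fintype.split i with inl j => f j | inr j => g j end).
  split=> [i|]; first by case: fintype.split.
  rewrite big_split_ord /=; congr (_ + _); apply: eq_bigr => i _.
    by rewrite (unsplitK (inl i)).
  by rewrite (unsplitK (inr i)).
- move=> b _ [n [c [f [Gf ->]]]]; exists n, (fun i => b * c i), f; split=> //.
  by rewrite scaler_sumr; apply: eq_bigr => i _; rewrite scalerA.
Qed.

Lemma hspan_min G S : hsubspace S -> G `<=` S -> hspan G `<=` S.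
Proof.
move=> hS GS _ [n [c [f [Gf ->]]]]; apply: (hsubspace_sum _ hS) => i _.
by have [_ _ SZ] := hS; apply/SZ/GS.
Qed.

End Span.

Lemma mono_scale (K : fieldType) (c : K) (x : rat) :
  hahn_mono c x = c *: hahn_mono 1 x.
Proof. by rewrite -[RHS]/(hahn_mono c 0 * _) hahn_monoM mulr1 add0r. Qed.

Section XiSpan.

Variables (p : nat) (p_ge2 : (1 < p)%N).
Local Notation phi := (@hahn_phi Qbar p p_ge2).

Lemma xi_ge0 t (w : Lambda t) (x : rat) : (0 < x) || (0 < t)%N -> 0 <= x ->
  xi p_ge2 w x = 0.
Proof.
have p_gt0 : 0 < (p%:R : rat) by rewrite ltr0n ltnW.
case: t w => [|t] w.
  rewrite orbF => x0 _; rewrite xi0 hcoef1.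
  by rewrite (negPf (lt0r_neq0 x0)).
move=> _ x0; apply: fsbig1 => k [_ kE]; exfalso; move: x0.
rewrite leNgt -kE oppr_lt0 big_ord_recl => /negP; apply.
apply: ltr_wpDr; last by rewrite divr_gt0 ?La_a_gt0 ?exprn_gt0.
by apply: sumr_ge0 => i _; rewrite divr_ge0 ?exprn_ge0 // ltW ?La_a_gt0.
Qed.

(** The trivial generator is excluded by its parameters, [g = 0] and [t = 0], and not by its value 1
    as in [V_space]; case distinctions then need no comparison of series. *)
Definition W_gen (s : nat) : set (hahn Qbar) :=
  [set f | exists g t (w : Lambda t),
     [/\ 0 <= g, (t <= s)%N, (0 < g) || (0 < t)%N &
         f = hahn_mono 1 (- g) * xi p_ge2 w]].

Definition W_space s : set (hahn Qbar) := hspan (W_gen s).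

Lemma W_subspace s : hsubspace (W_space s).
Proof. exact: hspan_subspace. Qed.

(** A generator of [W_gen] has no constant term by [xi_ge0], so it differs from 1. *)
Lemma W_sub_V s : W_space s `<=` V_space p_ge2 s.
Proof.
apply: hspan_min; first exact: hspan_subspace.
move=> f [g [t [w [g0 ts gt fE]]]]; apply: hspan_gen; split.
  by exists g, t, w.
move=> /= f1; have : f 0 = 1 by rewrite f1 hcoef1 eqxx.
rewrite fE hcoef_monoM mul1r sub0r opprK xi_ge0 // => /eqP.
by rewrite eq_sym oner_eq0.
Qed.

Lemma W_mem s g t (w : Lambda t) : 0 <= g -> (t <= s)%N ->
  (0 < g) || (0 < t)%N -> W_space s (hahn_mono 1 (- g) * xi p_ge2 w).
Proof. by move=> g0 ts gt; apply: hspan_gen; exists g, t, w. Qed.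

Lemma W_xi s t (w : Lambda t.+1) : (t < s)%N -> W_space s (xi p_ge2 w).
Proof.
by move=> ts; have := @W_mem s 0 t.+1 w; rewrite oppr0 hahn_mono1 mul1r; apply.
Qed.

Lemma W_mono s (x : rat) : 0 < x -> W_space s (hahn_mono 1 (- x)).
Proof.
move=> x0; pose w0 := @MkLambda 0 (fun=> 0%N) (fun=> 1) (fun=> 1)
  (fun=> oner_neq0 _) (fun=> ltr01).
have := @W_mem s x 0 w0 (ltW x0) (leq0n s).
by rewrite xi0 mulr1; apply; rewrite x0.
Qed.

Lemma W_le s s' : (s <= s')%N -> W_space s `<=` W_space s'.
Proof.
move=> ss; apply: hspan_min; first exact: hspan_subspace.
move=> f [g [t [w [g0 ts gt fE]]]]; apply: hspan_gen; exists g, t, w.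
by split=> //; apply: leq_trans ss.
Qed.

Lemma W_monoM s f (x : rat) : 0 <= x -> W_space s f ->
  W_space s (hahn_mono 1 (- x) * f).
Proof.
move=> x0; apply: (@hspan_min _ _ [set f | W_space s (hahn_mono 1 (- x) * f)]).
  have [W0 WD WZ] := W_subspace s.
  split=> [|g h|c g] /=; first by rewrite mulr0.
    by rewrite mulrDr; apply: WD.
  by rewrite -scalerAr; apply: WZ.
move=> _ [g [t [w [g0 ts gt ->]]]] /=.
rewrite mulrA hahn_monoM mulr1 -opprD; apply: W_mem => //; first exact: addr_ge0.
by case/orP: gt => [g1|->]; rewrite ?orbT // ltr_wpDl.
Qed.

Lemma W_negpolyM s q f : negpoly q -> W_space s f -> W_space s (q * f).
Proof.
move=> [k [r [k0 ->]]] Wf; rewrite mulr_suml.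
apply: hsubspace_sum => [|i _]; first exact: W_subspace.
have [_ _ WZ] := W_subspace s.
rewrite mono_scale -scalerAl; apply: WZ; apply: W_monoM => //.
by rewrite divr_ge0.
Qed.

Lemma W_negpoly s q : negpoly q -> W_space s (q - (q 0)%:A).
Proof.
move=> [k [r [k0 ->]]]; rewrite hcoef_sum scaler_suml -sumrB.
apply: hsubspace_sum => [|i _]; first exact: W_subspace.
have [W0 _ WZ] := W_subspace s.
have x0 : 0 <= (i%:R / k%:R : rat) by rewrite divr_ge0.
move: (_ / _) x0 => x; rewrite le_eqVlt => /orP[/eqP <-|x0].
  by rewrite oppr0 mono_scale hahn_mono1 hcoefZ hcoef1 eqxx mulr1 subrr.
rewrite mono_scale hcoefZ /= eq_sym oppr_eq0 (negPf (lt0r_neq0 x0)).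
by rewrite mulr0 scale0r subr0; apply/WZ/W_mono.
Qed.

(** In [phi_xi_cons] the terms of the sum keep the number of indices. The last term loses one but
    carries [z^(-a)] with [a > 0], so it is never the excluded generator. *)
Lemma W_phi s f : W_space s f -> W_space s (phi f).
Proof.
have [W0 WD WZ] := W_subspace s.
apply: (@hspan_min _ _ [set f | W_space s (phi f)]).
  split=> [|g h|c g] /=; first by rewrite rmorph0.
    by rewrite rmorphD; apply: WD.
  by rewrite phiZ; apply: WZ.
have p_gt0 : 0 < (p%:R : rat) by rewrite ltr0n ltnW.
move=> _ [g [t [w [g0 ts gt ->]]]] /=; rewrite phiM phi_mono.
case: t w ts gt => [|t] w ts gt.
  rewrite xi0 rmorph1 mulr1 mulNr; apply: W_mono.
  by rewrite mulr_gt0 //; move: gt; rewrite orbF.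
have [al [la [a [la0 [a0 [w' ->]]]]]] := LambdaS w.
rewrite mulNr; apply: W_monoM; first by rewrite mulr_ge0 // ltW.
rewrite phi_xi_cons; apply/WZ/WD.
  apply: hsubspace_sum => [|j _]; first exact: W_subspace.
  by apply/WZ/W_xi.
by apply: W_mem; rewrite ?a0 ?ltW // ltnW.
Qed.

Section Solve.

Variables (c c' : Qbar) (c_neq0 : c != 0) (c'_neq0 : c' != 0).

Definition W_image s : set (hahn Qbar) :=
  [set h | exists2 f, W_space s f & c *: f - c' *: phi f = h].

Lemma W_image_subspace s : hsubspace (W_image s).
Proof.
have [W0 WD WZ] := W_subspace s; split.
- by exists 0; rewrite // rmorph0 !scaler0 subrr.
- move=> _ _ [f Wf <-] [g Wg <-]; exists (f + g); first exact: WD.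
  by rewrite rmorphD !scalerDr opprD addrACA.
- move=> b _ [f Wf <-]; exists (b *: f); first exact: WZ.
  by rewrite phiZ scalerBr !scalerA ![b * _]mulrC.
Qed.

(** A new first index with [al = 0], [a = x] and [c' nu = c] makes the new series cancel in
    [c xi - c' phi(xi)], leaving [- c z^(-x) xi_w]. The extra index is why [s] grows by one. *)
Lemma W_image_mono s (x : rat) t (w : Lambda t) : 0 < x -> (t <= s)%N ->
  W_image s.+1 (hahn_mono 1 (- x) * xi p_ge2 w).
Proof.
move=> x0 ts; set mu := \prod_i La_lambda w i.
have mu0 : mu != 0 by apply/prodf_neq0 => i _; apply: La_lambda_neq0.
have la0 : c / c' / mu != 0 by rewrite !mulf_neq0 ?invr_eq0.
have [_ _ WZ] := W_subspace s.+1.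
exists (- c^-1 *: xi p_ge2 (Lcons 0 la0 x0 w)); first by apply/WZ/W_xi.
rewrite phiZ phi_xi_cons -/mu divfK // big_ord1 bin0 scale1r !scalerA.
have -> : c * - c^-1 = -1 by rewrite mulrN divff.
have -> : c' * - c^-1 * (c / c') = -1 by field; rewrite c_neq0 c'_neq0.
by rewrite !scaleN1r opprK addrA addNr add0r.
Qed.

(* On the span of the [xi (Lcons j ...)] the operator is triangular in [j], with
   diagonal entry [c - c' * nu]; in the resonant case it shifts [j] down by one. *)
Lemma W_image_xi s t (w : Lambda t.+1) : (t < s)%N -> W_image s.+1 (xi p_ge2 w).
Proof.
move=> ts; have [al [la [a [la0 [a0 [w' ->]]]]]] := LambdaS w.
set nu := la * \prod_i La_lambda w' i.
have nu0 : nu != 0.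
  by rewrite mulf_neq0 //; apply/prodf_neq0 => i _; apply: La_lambda_neq0.
pose xc j := xi p_ge2 (Lcons j la0 a0 w').
have hI := W_image_subspace s.+1; have [_ ID IZ] := hI.
have Ixc j : W_image s.+1 (c *: xc j - c' *: phi (xc j)).
  by exists (xc j) => //; apply: W_xi; rewrite ltnW.
have Iv : W_image s.+1 (hahn_mono 1 (- a) * xi p_ge2 w').
  by apply: W_image_mono; rewrite // ltnW.
elim/ltn_ind: al => al IH; rewrite -/(xc al).
pose S n := \sum_(j < al) 'C(n, j)%:R *: xc j + hahn_mono 1 (- a) * xi p_ge2 w'.
have IS n : W_image s.+1 (S n).
  by apply/ID => //; apply: hsubspace_sum => // j _; apply/IZ/IH.
(* In the resonant case the operator is applied to [xc al.+1]: the leading terms cancel, and [xc al]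
   remains with the factor [al.+1], which is nonzero in characteristic 0. *)
have [res|nres] := eqVneq (c' * nu) c.
  have E : c *: xc al.+1 - c' *: phi (xc al.+1) =
           - c *: (al.+1%:R *: xc al + S al.+1).
    rewrite phi_xi_cons -/nu scalerA res.
    rewrite [\sum_(_ < al.+2) _](_ : _ = \sum_(j < al) 'C(al.+1, j)%:R *: xc j +
        al.+1%:R *: xc al + xc al.+1); last first.
      by rewrite 2!big_ord_recr /= binn binSn scale1r.
    rewrite -/(xc _) -scalerBr scaleNr -scalerN; congr (_ *: _); rewrite /S.
    move: (\sum_(_ < _) _) (_ *: xc al) (xc al.+1) (_ * _).
    by clear => x y z v; ring.
  have -> : xc al = al.+1%:R^-1 *: ((- c)^-1 *:
      (c *: xc al.+1 - c' *: phi (xc al.+1)) - S al.+1).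
    rewrite E scalerA mulVf ?oppr_eq0 // scale1r addrK scalerA mulVf ?scale1r //.
    by rewrite pnatr_eq0.
  by apply/IZ/(hsubspaceB hI); [exact/IZ/Ixc | exact: IS].
have E : c *: xc al - c' *: phi (xc al) =
    (c - c' * nu) *: xc al - (c' * nu) *: S al.
  rewrite phi_xi_cons -/nu scalerA big_ord_recr /= binn scale1r -/(xc _).
  rewrite scalerBl -!addrA; congr (_ + _); rewrite -opprD -scalerDr.
  congr (- (_ *: _)).
  by rewrite /S addrCA addrA.
have -> : xc al = (c - c' * nu)^-1 *: ((c *: xc al - c' *: phi (xc al)) +
    (c' * nu) *: S al).
  by rewrite E subrK scalerA mulVf ?scale1r // subr_eq0 eq_sym.
by apply/IZ/ID; [exact: Ixc | exact/IZ/IS].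
Qed.

Lemma W_solve s h : W_space s h ->
  exists2 f, W_space s.+1 f & c *: f - c' *: phi f = h.
Proof.
apply: (@hspan_min _ _ (W_image s.+1)); first exact: W_image_subspace.
move=> _ [g [t [w [g0 ts gt ->]]]].
move: g0; rewrite le_eqVlt => /orP[/eqP gE|g0]; last exact: W_image_mono.
rewrite -gE ltxx /= oppr0 hahn_mono1 mul1r in gt *.
by case: t w ts gt => // t w ts _; apply: W_image_xi.
Qed.

End Solve.

End XiSpan.

(** * The factor F_2 and the theorem *)

Section Unipotent.

Variables (p : nat) (p_ge2 : (1 < p)%N).
Local Notation phi := (@hahn_phi Qbar p p_ge2).
Local Notation at0 := (fun f : hahn Qbar => f 0).

(** Column [j] is a scalar equation with right side in [W_space p_ge2 j], so [W_solve] puts [f j]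
    one space higher. In the enlarged matrix this entry stands [j.+1] places right of the
    diagonal. *)
Lemma W_row_solve n (a : Qbar) (c : 'I_n -> Qbar) (t : 'rV[hahn Qbar]_n)
    (C : 'M[Qbar]_n) (F : 'M[hahn Qbar]_n) :
  a != 0 -> (forall j, c j != 0) -> (forall j, negpoly (t 0 j)) ->
  (forall i j : 'I_n, (j < i)%N -> C i j = 0) -> (forall j, C j j = c j) ->
  (forall i j : 'I_n, (j < i)%N -> F i j = 0) -> (forall j, F j j = 1) ->
  (forall i j : 'I_n, (i < j)%N -> W_space p_ge2 (j - i) (F i j)) ->
  exists2 f : 'rV[hahn Qbar]_n, forall j : 'I_n, W_space p_ge2 j.+1 (f 0 j) &
    a%:A *: f + t *m F =
      map_mx (in_alg (hahn Qbar)) (map_mx at0 t) + map_mx phi f *m constmx C.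
Proof.
move=> a0 c0 nt upC dC upF dF WF.
(* What remains in column [j] once [a f j - c j phi(f j)] is isolated, by [F j j = 1] and
   [C j j = c j]. *)
pose h (j : 'I_n) (f : 'I_n -> hahn Qbar) :=
  ((t 0 j) 0)%:A - t 0 j + (\sum_(i < n | (i < j)%N) C i j *: phi (f i) -
  \sum_(i < n | (i < j)%N) t 0 i * F i j).
have [|j f Wf|f fP] := @ord_rec_choice (hahn Qbar) 0 n (fun j f x =>
    W_space p_ge2 j.+1 x /\ a *: x - c j *: phi x = h j f).
- move=> j f g x fg [Wx E]; split=> //; rewrite E /h.
  by congr (_ + (_ - _)); apply: eq_bigr => i /fg ->.
- have hW := W_subspace p_ge2 j; have [_ WD WZ] := hW.
  have [|x Wx xE] := @W_solve p p_ge2 a (c j) a0 (c0 j) j (h j f).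
    apply: WD.
      by rewrite -[_ - _]opprB -scaleN1r; apply/WZ/W_negpoly.
    apply: hsubspaceB => //; apply: hsubspace_sum => // i ij.
      by apply/WZ/W_phi; apply: (W_le _ (Wf i ij).1).
    apply: W_negpolyM => //; apply: (W_le _ (WF _ _ ij)).
    exact: leq_subr.
  by exists x.
exists (\row_j f j) => [j|]; first by rewrite mxE; case: (fP j).
apply/rowP => j; rewrite !mxE (sum_upper_col (fun i => t 0 i) j upF) dF mulr1.
have upC' (i k : 'I_n) : (k < i)%N -> constmx C i k = 0.
  by move=> ki; rewrite mxE upC //= scale0r.
rewrite (sum_upper_col (fun i => map_mx phi (\row_j f j) 0 i) j upC') !mxE dC.
rewrite mulr_algl [in_alg _ (c j)]/(_%:A) mulrC mulr_algl.
rewrite [X in _ = _ + (_ + X)](_ : _ =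
    \sum_(i < n | (i < j)%N) C i j *: phi (f i)); last first.
  by apply: eq_bigr => i _; rewrite !mxE mulrC mulr_algl.
have alg (v z x y u : hahn Qbar) :
  v - z + (x - y) + u + (z + y) = v + (u + x) by ring.
have [_ E] := fP j; rewrite -[a *: f j](subrK (c j *: phi (f j))) E.
exact: alg.
Qed.

(** The lower right block is solved first and the row above it by [W_row_solve]; the distance to the
    diagonal is the index of the space. *)
Lemma W_triangular_solve d (T : 'M[hahn Qbar]_d) (c : 'I_d -> Qbar) :
  (forall j, c j != 0) -> (forall i j : 'I_d, (j < i)%N -> T i j = 0) ->
  (forall j, T j j = (c j)%:A) -> (forall i j, negpoly (T i j)) ->
  exists F : 'M[hahn Qbar]_d,
    [/\ forall i j : 'I_d, (j < i)%N -> F i j = 0, forall j, F j j = 1,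
        forall i j : 'I_d, (i < j)%N -> W_space p_ge2 (j - i) (F i j) &
        T *m F = map_mx phi F *m constmx (map_mx at0 T)].
Proof.
elim: d T c => [|d IH] T c c0 upT dT nT.
  exists 1%:M; split=> [[]|[]|[]|] //.
  by apply/matrixP => -[].
(* Retyping by conversion of [d.+1] to [1 + d], for the block operations. *)
pose T0 : 'M[hahn Qbar]_(1 + d) := T.
pose T' := drsubmx T0; pose t := ursubmx T0.
pose a := c (lshift d 0 : 'I_(1 + d)).
pose c' (j : 'I_d) := c (rshift 1 j : 'I_(1 + d)).
have upT' (i j : 'I_d) : (j < i)%N -> T' i j = 0.
  by move=> ji; rewrite /T' !mxE; apply: upT; rewrite /= ltn_add2l.
have dT' j : T' j j = (c' j)%:A by rewrite /T' !mxE; apply: dT.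
have nT' i j : negpoly (T' i j) by rewrite /T' !mxE; apply: nT.
have nt j : negpoly (t 0 j) by rewrite /t !mxE; apply: nT.
have TE : T0 = block_mx (a%:A)%:M t 0 T'.
  rewrite -[LHS]submxK; congr block_mx.
    by apply/matrixP => i j; rewrite !ord1 !mxE eqxx; apply: dT.
  apply/matrixP => i j; rewrite !mxE; apply: upT => /=.
  by rewrite (leq_trans (ltn_ord j)) // leq_addr.
have [F [upF dF WF FE]] := IH T' c' (fun j => c0 _) upT' dT' nT'.
pose C' := map_mx at0 T'.
have upC (i j : 'I_d) : (j < i)%N -> C' i j = 0.
  by move=> ji; rewrite mxE upT'.
have dC j : C' j j = c' j by rewrite mxE dT' hcoefZ hcoef1 eqxx mulr1.
have [f Wf fE] := @W_row_solve d a c' t C' F (c0 _) (fun j => c0 _) nt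
  upC dC upF dF WF.
pose G : 'M[hahn Qbar]_(1 + d) := block_mx 1%:M f 0 F.
have GE : T0 *m G = map_mx phi G *m constmx (map_mx at0 T0).
  have -> : constmx (map_mx at0 T0) = block_mx (a%:A)%:M
      (map_mx (in_alg (hahn Qbar)) (map_mx at0 t)) 0 (constmx C').
    rewrite TE /constmx !map_block_mx; congr block_mx.
      apply/matrixP => i j; rewrite !ord1 !mxE eqxx mulr1n.
      by rewrite hcoefZ hcoef1 eqxx mulr1.
    by apply/matrixP => i j; rewrite !mxE hcoef0 /= scale0r.
  rewrite TE /G map_block_mx map_mx1 map_mx0 !mulmx_block.
  rewrite !mulmx0 !mul0mx !mulmx1 !mul1mx !addr0 !add0r FE -fE.
  congr (block_mx _ (_ + _) _ _).
  by apply/matrixP => i j; rewrite !mxE big_ord1 !mxE !ord1 eqxx mulr1n.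
exists G; split=> //.
- suff H (i j : 'I_(1 + d)) : (j < i)%N -> G i j = 0 by exact: H.
  case: (split_ordP i) => i' ->; case: (split_ordP j) => j' ->;
    rewrite /G ?block_mxEul ?block_mxEur ?block_mxEdl ?block_mxEdr.
  + by rewrite !ord1 ltnn.
  + by rewrite /= ltnNge ltnW // (leq_trans (ltn_ord i')) // leq_addr.
  + by rewrite mxE.
  + by rewrite /= ltn_add2l => ij; apply: upF.
- suff H (i : 'I_(1 + d)) : G i i = 1 by exact: H.
  by case: (split_ordP i) => i' ->; rewrite /G ?block_mxEul ?block_mxEdr ?dF //
    mxE eqxx.
- suff H (i j : 'I_(1 + d)) : (i < j)%N -> W_space p_ge2 (j - i) (G i j).
    exact: H.
  case: (split_ordP i) => i' ->; case: (split_ordP j) => j' ->;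
    rewrite /G ?block_mxEul ?block_mxEur ?block_mxEdl ?block_mxEdr.
  + by rewrite !ord1 ltnn.
  + by rewrite ord1 /= subn0.
  + by rewrite /= ltnNge ltnW // (leq_trans (ltn_ord j')) // leq_addr.
  + by rewrite /= ltn_add2l subnDl => ij; apply: WF.
Qed.

End Unipotent.

(** * Inverses over the polynomials in z^(-1/k), and the assembly *)

Definition negpoly_pred : {pred hahn Qbar} := fun f => `[< negpoly f >].

Lemma negpoly_subring_closed : subring_closed negpoly_pred.
Proof.
have frac (m k l : nat) : (0 < l)%N ->
    - (m%:R / k%:R) = - ((m * l)%N%:R / (k * l)%N%:R) :> rat.
  move=> l0; rewrite !natrM -mulf_div divff ?mulr1 //.
  by rewrite pnatr_eq0 -lt0n.
split=> [|f g /asboolP/negpolyP[k [N [k0 fN]]] /asboolP/negpolyP[l [M [l0 gM]]]|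
  f g /asboolP/negpolyP[k [N [k0 fN]]] /asboolP/negpolyP[l [M [l0 gM]]]];
  apply/asboolP.
- by rewrite -[1]scale1r; apply: negpoly_const.
- apply/negpolyP; exists (k * l)%N, (N * l + M * k)%N.
  split=> [|x]; first by rewrite muln_gt0 k0.
  rewrite hcoefD hcoefN; have [->|fx _] := eqVneq (f x) 0.
    rewrite sub0r oppr_eq0 => /gM[m mM ->]; exists (m * k)%N.
      by rewrite (leq_trans _ (leq_addl _ _)) // leq_mul2r mM orbT.
    by rewrite (frac m l k) // [(l * k)%N]mulnC.
  have [m mN ->] := fN _ fx; exists (m * l)%N; last exact: frac.
  by rewrite (leq_trans _ (leq_addr _ _)) // leq_mul2r mN orbT.
- apply/negpolyP; exists (k * l)%N, (N * l + M * k)%N.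
  split=> [|x /hcoefM_neq0[y /fN[m mN yE] /gM[n nM]]].
    by rewrite muln_gt0 k0.
  rewrite yE => xE; exists (m * l + n * k)%N.
    by rewrite leq_add // leq_mul2r ?mN ?nM orbT.
  rewrite natrD mulrDl opprD -(frac m k l) // [(k * l)%N]mulnC -(frac n l k) //.
  rewrite -xE.
  by rewrite addrC subrK.
Qed.

HB.instance Definition _ :=
  GRing.isSubringClosed.Build (hahn Qbar) negpoly_pred negpoly_subring_closed.

Lemma det_upper (R : comPzRingType) n (T : 'M[R]_n) :
  (forall i j : 'I_n, (j < i)%N -> T i j = 0) -> \det T = \prod_i T i i.
Proof.
move=> upT; rewrite -det_tr det_trig.
  by apply: eq_bigr => i _; rewrite mxE.
by apply/is_trig_mxP => i j ij; rewrite mxE upT.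
Qed.

Lemma rpred_det (R : comNzRingType) (S : subringClosed R) n (M : 'M[R]_n) :
  (forall i j, M i j \in S) -> \det M \in S.
Proof.
move=> MS; apply: rpred_sum => s _; apply: rpredM; last exact: rpred_prod.
by rewrite rpredX // rpredN rpred1.
Qed.

(** The determinant is a nonzero constant, the product of the [c j], so the adjugate formula stays
    within the polynomials. *)
Lemma upper_negpoly_inv d (T : 'M[hahn Qbar]_d) (c : 'I_d -> Qbar) :
  (forall j, c j != 0) -> (forall i j : 'I_d, (j < i)%N -> T i j = 0) ->
  (forall j, T j j = (c j)%:A) -> (forall i j, negpoly (T i j)) ->
  GL_over negpoly T.
Proof.
move=> c0 upT dT nT.
pose m := \prod_j c j.
have m0 : m != 0 by apply/prodf_neq0.
have detT : \det T = m%:A.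
  rewrite (det_upper upT) /m -[RHS]/(in_alg _ _) rmorph_prod.
  by apply: eq_bigr => j _; rewrite dT.
have detV : (\det T)^-1 = (m^-1)%:A.
  by rewrite detT -[LHS]/((in_alg _ _)^-1) -fmorphV.
have uT : T \in unitmx.
  by rewrite unitmxE detT unitfE scaler_eq0 negb_or m0 oner_eq0.
split=> // i j; rewrite /invmx uT detV mxE.
have nM (M : 'M[hahn Qbar]_d.-1) : (forall i j, negpoly (M i j)) ->
    \det M \in negpoly_pred.
  by move=> nM; apply: rpred_det => k l; apply/asboolP.
suff /asboolP : (m^-1)%:A * (\adj T) i j \in negpoly_pred by [].
apply: rpredM; first exact/asboolP/negpoly_const.
rewrite mxE; apply: rpredM; first by rewrite rpredX // rpredN rpred1.
by apply: nM => k l; rewrite !mxE.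
Qed.

(** With all blocks of size 1, block and matrix indices agree, and the block conditions become
    entrywise. *)
Lemma mxblk1E (R : Type) d (rd : (d = \sum_(i < d) 1)%N) (M : 'M[R]_d) i j a b :
  mxblk rd M i j a b = M i j.
Proof.
have rankE (k : 'I_d) (u : 'I_1) : cast_ord (esym rd) (tagnat.Rank k u) = k.
  apply: val_inj; apply: etrans (tagnat.RankEsum u) _; rewrite ord1 addn0.
  rewrite -(big_ord_widen d (fun=> 1%N) (ltnW (ltn_ord k))).
  by rewrite sum_nat_const card_ord muln1.
by rewrite /mxblk mxE castmxE /= !rankE.
Qed.

Theorem theorem4p3 (p : nat) (p_ge2 : (1 < p)%N) (d : nat) (d_gt0 : (0 < d)%N)
    (A : 'M[hahn Qbar]_d) (A_GL : GL_over puiseux A) :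
  exists (sigma : nat) (r : 'I_sigma -> nat)
    (rd : (d = \sum_(i < sigma) r i)%N)
    (Theta : 'M[hahn Qbar]_d) (B : forall i : 'I_sigma, 'M[Qbar]_(r i))
    (C : 'M[Qbar]_d) (F1 F2 : 'M[hahn Qbar]_d),
    ((0 < sigma)%N /\ (forall i, (0 < r i)%N)) /\
    (GL_over negpoly Theta /\ block_upper rd Theta /\
     (forall i, B i \in unitmx /\ mxblk rd Theta i i = constmx (B i)) /\
     C = map_mx (fun f : hahn Qbar => f 0) Theta /\ C \in unitmx) /\
    GL_over puiseux F1 /\
    frakV p_ge2 rd F2 /\
    A = phimx p_ge2 F1 *m Theta *m invmx F1 /\
    Theta = phimx p_ge2 F2 *m constmx C *m invmx F2 /\
    (F1 *m F2 \in unitmx /\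
     A = phimx p_ge2 (F1 *m F2) *m constmx C *m invmx (F1 *m F2)).
Proof.
have [uA pA _] := A_GL.
have /choice[e eP] : forall ij : 'I_d * 'I_d,
    exists f : puis, pval f = A ij.1 ij.2.
  by move=> ij; apply: mkpuis.
pose A' := \matrix_(i, j) e (i, j).
have AE : map_mx val A' = A by apply/matrixP => i j; rewrite !mxE; apply: eP.
have uA' : A' \in unitmx by rewrite -(map_unitmx val) AE.
have [F [T [c [uF c0 [upT dT] nT FE]]]] := puiseux_triangularization p_ge2 uA'.
pose F1 := map_mx val F; pose Th := map_mx val T.
have uF1 : F1 \in unitmx by rewrite map_unitmx.
have AF1 : A *m F1 = phimx p_ge2 F1 *m Th.
  rewrite -AE -map_mxM FE map_mxM; congr (_ *m _).
  by apply/matrixP => i j; rewrite !mxE.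
have upTh (i j : 'I_d) : (j < i)%N -> Th i j = 0.
  by move=> ji; rewrite mxE upT //; apply: pval0.
have dTh j : Th j j = (c j)%:A by rewrite mxE dT.
have nTh i j : negpoly (Th i j) by rewrite mxE; apply: nT.
have [F2 [upF dF WF F2E]] := W_triangular_solve p_ge2 c0 upTh dTh nTh.
pose C := map_mx (fun f : hahn Qbar => f 0) Th.
have uF2 : F2 \in unitmx.
  by rewrite unitmxE (det_upper upF) big1 ?unitr1.
have uC : C \in unitmx.
  rewrite unitmxE det_upper => [|i j ji]; last by rewrite mxE upTh.
  rewrite unitfE; apply/prodf_neq0 => j _.
  by rewrite mxE dTh hcoefZ hcoef1 eqxx mulr1.
have rd : (d = \sum_(i < d) 1)%N by rewrite sum_nat_const card_ord muln1.
have ThE : Th = phimx p_ge2 F2 *m constmx C *m invmx F2.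
  by rewrite -[LHS](mulmxK uF2) F2E.
have AThE : A = phimx p_ge2 F1 *m Th *m invmx F1.
  by rewrite -[LHS](mulmxK uF1) AF1.
have uF12 : F1 *m F2 \in unitmx by rewrite unitmx_mul uF1.
have AF12 : A *m (F1 *m F2) = phimx p_ge2 (F1 *m F2) *m constmx C.
  have -> : phimx p_ge2 (F1 *m F2) = phimx p_ge2 F1 *m phimx p_ge2 F2.
    exact: map_mxM.
  by rewrite -(mulmxA (phimx _ _) (phimx _ _)) -F2E !mulmxA AF1.
exists d, (fun=> 1%N), rd, Th, (fun i => (c i)%:M), C, F1, F2.
split; [by [] | split; [split; [|split; [|split; [|split]]] |
  split; [|split; [|split; [|split; [|split]]]]]] => //.
- exact: upper_negpoly_inv dTh nTh.
- by move=> i j ji; apply/matrixP => a b; rewrite mxblk1E upTh // mxE.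
- move=> i; split; first by rewrite unitmxE det_scalar expr1 unitfE.
  by apply/matrixP => a b; rewrite mxblk1E dTh !mxE !ord1 eqxx.
- split=> // i j; first by rewrite mxE; apply: puisP.
  (* The embedding of the field [puis] commutes with matrix inversion, so the inverse has Puiseux
     entries. *)
  by rewrite /F1 -map_invmx mxE; apply: puisP.
- split=> //.
  + by move=> i j ji; apply/matrixP => a b; rewrite mxblk1E upF // mxE.
  + by move=> i; apply/matrixP => a b; rewrite mxblk1E dF mxE !ord1 eqxx.
  + by move=> i j ij a b; rewrite mxblk1E; apply/W_sub_V/WF.
- by rewrite -AF12 mulmxK.
Qed.
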